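(* Let $A$ be a noetherian ring, let $M$ be a finite $A$-module, and let $S$ be the set of all subsets $T\subseteq\operatorname{Min}_A(M)$ for which there exists $\mathfrak q\in\operatorname{Supp}_A(M)$ such that $\operatorname{ht}(\mathfrak q/\mathfrak p)$ is constant for all $\mathfrak p\in T$ (so that, in particular, $\mathfrak p\subseteq\mathfrak q$ for all $\mathfrak p\in T$). For each $T\in S$, assign a submodule $M^T$ of $M$ with $\operatorname{Ass}_A(M^T)=T$ and $\operatorname{Ass}_A(M/M^T)=\operatorname{Ass}_A(M)\setminus T$. Then $$\operatorname{CM}(M)=\bigcup_{T\in S}\Bigl(\operatorname{CM}(M^T)\setminus\bigcup_{\mathfrak p\in\operatorname{Ass}_A(M)\setminus T}V(\mathfrak p)\Bigr).$$
   Context: Rings are commutative; ''finite module'' means finitely generated. $\operatorname{Min}_A(M)$ is the set of minimal elements of $\operatorname{Supp}_A(M)$, and $\operatorname{Ass}_A$ denotes the set of associated primes. For a finite $A$-module $N$, the Cohen–Macaulay locus is $\operatorname{CM}(N)=\{\mathfrak p\in\operatorname{Spec}A: N_{\mathfrak p}\text{ is Cohen–Macaulay as an }A_{\mathfrak p}\text{-module}\}$. $V(\mathfrak p)$ is the set of prime ideals of $A$ containing $\mathfrak p$.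
   Formalization: The module M is assumed nonzero: for M = 0 over a nonzero ring the set S is empty, so the right-hand side is empty, while CM(0) = Spec A because the zero module counts as Cohen–Macaulay. *)

(* Defs.v *)
From HB Require Import structures.
From mathcomp Require Import all_boot all_order all_algebra.
From mathcomp Require Import generic_quotient ring_quotient.
From mathcomp Require Import boolp classical_sets constructive_ereal.
From mathcomp Require Import ring.

Set Implicit Arguments.
Unset Strict Implicit.
Unset Printing Implicit Defensive.

Import GRing.Theory.
Local Open Scope classical_set_scope.
Local Open Scope ring_scope.
Local Open Scope quotient_scope.

(* The points of Spec A. The structure type [prime_idealr A] lives in too     *)
(* large a universe for [set (prime_idealr A)] to be well-typed.              *)

Record spec (A : comNzRingType) := Spec {
  spec_mem : A -> bool;
  spec_ideal : idealr_closed spec_mem;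
  spec_prime : prime_idealr_closed spec_mem
}.

Definition pred_of_spec (A : comNzRingType) (p : spec A) : {pred A} :=
  spec_mem p.
Coercion pred_of_spec : spec >-> pred_sort.

HB.instance Definition _ (A : comNzRingType) (p : spec A) :=
  isIdealr.Build A (pred_of_spec p) (@spec_ideal A p).
HB.instance Definition _ (A : comNzRingType) (p : spec A) :=
  isPrimeIdealrClosed.Build A (pred_of_spec p) (@spec_prime A p).

Definition spec_idealr (A : comNzRingType) (p : spec A) : prime_idealr A :=
  PrimeIdealr.clone A (pred_of_spec p) _.

Lemma spec_ext (A : comNzRingType) (p q : spec A) : p =i q -> p = q.
Proof.
case: p => p p1 p2; case: q => q q1 q2 pq.
have {pq}e : p = q by apply: funext => x; exact: pq.
case: _ / e in q1 q2 *.
by rewrite (Prop_irrelevance p1 q1) (Prop_irrelevance p2 q2).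
Qed.

Definition submod_type (A : comNzRingType) (M : lmodType A)
  (N : submodClosed M) := {x : M | x \in N}.

HB.instance Definition _ (A : comNzRingType) (M : lmodType A)
  (N : submodClosed M) := SubChoice.on (submod_type N).
HB.instance Definition _ (A : comNzRingType) (M : lmodType A)
  (N : submodClosed M) := [SubChoice_isSubLmodule of submod_type N by <:].

(* Quotient modules: MathComp only provides the underlying additive group,    *)
(* for a predicate known to be closed under opposites.                        *)

Section QuotientModule.
Variables (A : comNzRingType) (M : lmodType A) (N : submodClosed M).

Definition submod_pred : pred M := fun x => x \in N.

Fact submod_pred_zmod_closed : zmod_closed submod_pred.
Proof. exact: (GRing.submod_closedB (submodClosedP N)). Qed.

HB.instance Definition _ :=
  GRing.isZmodClosed.Build M submod_pred submod_pred_zmod_closed.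

Definition submod_zmod : zmodClosed M :=
  GRing.ZmodClosed.clone M submod_pred _.

Definition quotmod := Quotient.quot submod_zmod.

HB.instance Definition _ := GRing.Zmodule.on quotmod.
HB.instance Definition _ := EqQuotient.on quotmod.

Lemma quotmodP (x y : M) :
  reflect (x = y %[mod quotmod]) (x - y \in N).
Proof.
by rewrite -[_ \in N]/(_ \in submod_zmod) Quotient.idealrBE; exact: eqP.
Qed.

Definition quotmod_scale (a : A) (x : quotmod) : quotmod :=
  \pi_quotmod (a *: repr x).

Lemma pi_quotmod_scale a (x : M) :
  quotmod_scale a (\pi_quotmod x) = \pi_quotmod (a *: x).
Proof.
rewrite /quotmod_scale; apply/quotmodP; rewrite -scalerBr.
by apply: rpredZ; apply/quotmodP; rewrite reprK.
Qed.

Lemma pi_quotmodD (x y : M) :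
  \pi_quotmod (x + y) = \pi_quotmod x + \pi_quotmod y.
Proof. exact: (Quotient.pi_add submod_zmod). Qed.

Lemma quotmodW (P : quotmod -> Prop) :
  (forall x, P (\pi_quotmod x)) -> forall y, P y.
Proof. by move=> h y; rewrite -[y]reprK; exact: h. Qed.

Fact quotmod_scaleA a b x :
  quotmod_scale a (quotmod_scale b x) = quotmod_scale (a * b) x.
Proof. by elim/quotmodW: x => x; rewrite !pi_quotmod_scale scalerA. Qed.

Fact quotmod_scale1 : left_id 1 quotmod_scale.
Proof. by elim/quotmodW => x; rewrite pi_quotmod_scale scale1r. Qed.

Fact quotmod_scaleDr : right_distributive quotmod_scale +%R.
Proof.
move=> a; elim/quotmodW => x; elim/quotmodW => y.
by rewrite -pi_quotmodD !pi_quotmod_scale -pi_quotmodD scalerDr.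
Qed.

Fact quotmod_scaleDl x : {morph quotmod_scale^~ x : a b / a + b}.
Proof.
move=> a b; elim/quotmodW: x => x.
by rewrite !pi_quotmod_scale -pi_quotmodD scalerDl.
Qed.

HB.instance Definition _ := GRing.Zmodule_isLmodule.Build A quotmod
  quotmod_scaleA quotmod_scale1 quotmod_scaleDr quotmod_scaleDl.

End QuotientModule.

(* Localization at a prime: [locmod p M] is M_p and [locring p] is A_p.       *)

Section Localization.
Variables (A : comNzRingType) (p : spec A).

Definition denom := {s : A | s \notin p}.
HB.instance Definition _ := SubChoice.on denom.

Fact denom1_subproof : 1 \notin p.
Proof. by rewrite (idealr1 (spec_idealr p)). Qed.
Definition denom1 : denom := exist (fun s => s \notin p) 1 denom1_subproof.

Fact denomM_subproof (s t : denom) : val s * val t \notin p.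
Proof.
by rewrite (prime_idealrM (spec_idealr p)) negb_or (valP s) (valP t).
Qed.
Definition denomM (s t : denom) : denom :=
  exist (fun s => s \notin p) _ (denomM_subproof s t).

Lemma denommA : associative denomM.
Proof. by move=> x y z; apply: val_inj; rewrite /= mulrA. Qed.
Lemma denommC : commutative denomM.
Proof. by move=> x y; apply: val_inj; rewrite /= mulrC. Qed.
Lemma denomm1 : left_id denom1 denomM.
Proof. by move=> x; apply: val_inj; rewrite /= mul1r. Qed.

Section LocalizedGroup.
Variable M : lmodType A.

Definition loc_equiv (x y : M * denom) : bool :=
  `[< exists u : denom,
      (val u * val y.2) *: x.1 = (val u * val x.2) *: y.1 >].

Fact loc_equiv_is_equiv : equiv_class_of loc_equiv.
Proof.
split=> [x|x y|y x z]; first by apply/asboolP; exists denom1.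
  by apply/asboolP/asboolP => -[u e]; exists u.
move=> /asboolP[u e] /asboolP[v f]; apply/asboolP.
exists (denomM (denomM u v) (y.2)) => /=.
have -> : val u * val v * val y.2 * val z.2 =
  (val v * val z.2) * (val u * val y.2) by ring.
rewrite -scalerA e scalerA.
have -> : val v * val z.2 * (val u * val x.2) =
  (val u * val x.2) * (val v * val z.2) by ring.
by rewrite -scalerA f scalerA; congr (_ *: _); rewrite /=; ring.
Qed.

Canonical loc_equiv_equiv := EquivRelPack loc_equiv_is_equiv.
Canonical loc_equiv_encModRel := defaultEncModRel loc_equiv.

Definition locmod := {eq_quot loc_equiv}.
HB.instance Definition _ : EqQuotient (M * denom)%type loc_equiv locmod :=
  EqQuotient.on locmod.
HB.instance Definition _ := Choice.on locmod.

Definition loc_frac (x : M) (s : denom) : locmod := \pi_locmod (x, s).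

Lemma loc_frac_eqP x s y t : loc_frac x s = loc_frac y t <->
  exists u : denom, (val u * val t) *: x = (val u * val s) *: y.
Proof.
split=> [/eqP|[u e]]; first by rewrite piE => /asboolP.
by apply/eqP; rewrite piE; apply/asboolP; exists u.
Qed.

Lemma loc_fracW (P : locmod -> Prop) :
  (forall x s, P (loc_frac x s)) -> forall z, P z.
Proof.
by move=> h z; rewrite -[z]reprK; case: (repr z) => x s; exact: h.
Qed.

Definition loc_zero : locmod := loc_frac 0 denom1.

Definition loc_opp (z : locmod) : locmod :=
  let x := repr z in loc_frac (- x.1) x.2.

Definition loc_add (z w : locmod) : locmod :=
  let x := repr z in let y := repr w in
  loc_frac (val y.2 *: x.1 + val x.2 *: y.1) (denomM x.2 y.2).

Lemma repr_loc_frac x s : exists u : denom,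
  (val u * val s) *: (repr (loc_frac x s)).1 =
  (val u * val (repr (loc_frac x s)).2) *: x.
Proof.
apply/loc_frac_eqP; rewrite /loc_frac -surjective_pairing; exact: reprK.
Qed.

Lemma loc_oppE x s : loc_opp (loc_frac x s) = loc_frac (- x) s.
Proof.
rewrite /loc_opp; have [u e] := repr_loc_frac x s.
by apply/loc_frac_eqP; exists u; rewrite !scalerN e.
Qed.

Lemma loc_addE x s y t :
  loc_add (loc_frac x s) (loc_frac y t) =
  loc_frac (val t *: x + val s *: y) (denomM s t).
Proof.
rewrite /loc_add; have [u e] := repr_loc_frac x s; have [v f] := repr_loc_frac y t.
case: (repr (loc_frac x s)) e => x' s' /= e.
case: (repr (loc_frac y t)) f => y' t' /= f.
apply/loc_frac_eqP; exists (denomM u v) => /=; rewrite !scalerDr !scalerA.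
congr (_ + _).
- have -> : val u * val v * (val s * val t) * val t' =
    (val v * val t * val t') * (val u * val s) by ring.
  by rewrite -scalerA e scalerA; congr (_ *: _); rewrite /=; ring.
- have -> : val u * val v * (val s * val t) * val s' =
    (val u * val s * val s') * (val v * val t) by ring.
  by rewrite -scalerA f scalerA; congr (_ *: _); rewrite /=; ring.
Qed.

Lemma loc_frac_eq x s y t : val t *: x = val s *: y -> loc_frac x s = loc_frac y t.
Proof. by move=> e; apply/loc_frac_eqP; exists denom1; rewrite /= !mul1r. Qed.

Fact loc_addA : associative loc_add.
Proof.
apply: loc_fracW => x s; apply: loc_fracW => y t; apply: loc_fracW => z r.
rewrite !loc_addE; apply: loc_frac_eq => /=; rewrite !scalerDr !scalerA -!addrA.
by congr (_ *: _ + (_ *: _ + _ *: _)); rewrite /=; ring.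
Qed.

Fact loc_addC : commutative loc_add.
Proof.
apply: loc_fracW => x s; apply: loc_fracW => y t; rewrite !loc_addE.
by apply: loc_frac_eq; rewrite /= addrC mulrC.
Qed.

Fact loc_add0 : left_id loc_zero loc_add.
Proof.
apply: loc_fracW => x s; rewrite loc_addE; apply: loc_frac_eq => /=.
by rewrite scaler0 add0r scale1r mul1r.
Qed.

Fact loc_addN : left_inverse loc_zero loc_opp loc_add.
Proof.
apply: loc_fracW => x s; rewrite loc_oppE loc_addE; apply: loc_frac_eq => /=.
by rewrite scalerN addNr !scaler0.
Qed.

HB.instance Definition _ :=
  GRing.isZmodule.Build locmod loc_addA loc_addC loc_add0 loc_addN.

Lemma loc_fracD x s y t :
  loc_frac x s + loc_frac y t = loc_frac (val t *: x + val s *: y) (denomM s t).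
Proof. exact: loc_addE. Qed.

(* (a / s) (x / t) = (a x) / (s t) *)
Definition loc_scale_pre (r : A * denom) (z : locmod) : locmod :=
  let x := repr z in loc_frac (r.1 *: x.1) (denomM r.2 x.2).

Lemma loc_scale_preE a s x t :
  loc_scale_pre (a, s) (loc_frac x t) = loc_frac (a *: x) (denomM s t).
Proof.
rewrite /loc_scale_pre; have [u e] := repr_loc_frac x t.
move: (repr _) e => [x' t'] /= e; apply/loc_frac_eqP; exists u => /=.
rewrite !scalerA.
have -> : val u * (val s * val t) * a = (val s * a) * (val u * val t) by ring.
by rewrite -scalerA e scalerA; congr (_ *: _); rewrite /=; ring.
Qed.

End LocalizedGroup.

Definition locring := locmod A^o.
HB.instance Definition _ := GRing.Zmodule.on locring.
HB.instance Definition _ := EqQuotient.on locring.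

Definition loc_scale (M : lmodType A) (r : locring) (z : locmod M) : locmod M :=
  loc_scale_pre (repr r) z.

Lemma loc_scaleE (M : lmodType A) (a : A) s (x : M) t :
  loc_scale (loc_frac (a : A^o) s : locring) (loc_frac x t) =
  loc_frac (a *: x) (denomM s t).
Proof.
rewrite /loc_scale; have [u e] := repr_loc_frac (a : A^o) s.
move: (repr _) e => [b r] /= e; rewrite loc_scale_preE.
apply/loc_frac_eqP; exists u => /=; rewrite !scalerA; congr (_ *: _).
have {}e : val u * val s * b = val u * val r * a := e.
transitivity (val u * val s * b * val t); first by rewrite /=; ring.
by rewrite e /=; ring.
Qed.

Lemma locringW (P : locring -> Prop) :
  (forall (a : A) s, P (loc_frac (a : A^o) s)) -> forall r, P r.
Proof. exact: (@loc_fracW A^o P). Qed.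

Definition loc_one : locring := loc_frac (1 : A^o) denom1.
Definition loc_mul : locring -> locring -> locring := @loc_scale A^o.

Lemma loc_mulE (a b : A) s t :
  loc_mul (loc_frac (a : A^o) s) (loc_frac (b : A^o) t) =
  loc_frac (a * b : A^o) (denomM s t).
Proof. exact: loc_scaleE. Qed.

Section ScaleAxioms.
Variable M : lmodType A.

Fact loc_scaleA (r r' : locring) (z : locmod M) :
  loc_scale r (loc_scale r' z) = loc_scale (loc_mul r r') z.
Proof.
move: r r' z; apply: locringW => a s.
apply: locringW => b t; apply: loc_fracW => x w.
by rewrite loc_mulE !loc_scaleE scalerA denommA.
Qed.

Fact loc_scale1 (z : locmod M) : loc_scale loc_one z = z.
Proof. by move: z; apply: loc_fracW => x s; rewrite loc_scaleE scale1r denomm1. Qed.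

Fact loc_scaleDr : right_distributive (@loc_scale M) +%R.
Proof.
apply: locringW => a s; apply: loc_fracW => x t; apply: loc_fracW => y w.
rewrite loc_fracD !loc_scaleE loc_fracD; apply: loc_frac_eq => /=.
by rewrite !scalerDr !scalerA; congr (_ *: _ + _ *: _); rewrite /=; ring.
Qed.

Fact loc_scaleDl (z : locmod M) :
  {morph (fun r => loc_scale r z) : r r' / (r + r' : locring) >-> r + r'}.
Proof.
move=> r r'; move: r r' z; apply: locringW => a s.
apply: locringW => b t; apply: loc_fracW => x w.
have -> : (loc_frac (a : A^o) s : locring) + loc_frac (b : A^o) t =
  loc_frac (val t * a + val s * b : A^o) (denomM s t) by exact: loc_fracD.
rewrite !loc_scaleE loc_fracD; apply: loc_frac_eq => /=.
by rewrite !scalerDl !scalerDr !scalerA; congr (_ *: _ + _ *: _); rewrite /=; ring.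
Qed.

End ScaleAxioms.

Fact loc_mulC : commutative loc_mul.
Proof.
apply: locringW => a s; apply: locringW => b t; rewrite !loc_mulE.
by rewrite denommC; congr loc_frac; exact: mulrC.
Qed.

Fact loc_mulA : associative loc_mul.
Proof. exact: loc_scaleA. Qed.

Fact loc_mul1 : left_id loc_one loc_mul.
Proof. exact: loc_scale1. Qed.

Fact loc_mulDl : left_distributive loc_mul +%R.
Proof. by move=> r r' z; exact: loc_scaleDl. Qed.

Fact loc_one_neq0 : loc_one != 0.
Proof.
apply/eqP => /loc_frac_eqP[u /= e]; have := valP u; rewrite /=.
have {e} : val u * 1 * 1 = val u * 1 * 0 := e.
by rewrite !mulr1 mulr0 => ->; rewrite idealr0.
Qed.

HB.instance Definition _ := GRing.Zmodule_isComNzRing.Build locring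
  loc_mulA loc_mulC loc_mul1 loc_mulDl loc_one_neq0.

HB.instance Definition _ (M : lmodType A) :=
  GRing.Zmodule_isLmodule.Build locring (locmod M)
    (@loc_scaleA M) (@loc_scale1 M) (@loc_scaleDr M) (@loc_scaleDl M).

End Localization.

Definition spanned (A : comNzRingType) (M : lmodType A) (s : seq M) : set M :=
  [set x | exists c : nat -> A, x = \sum_(i < size s) c i *: s`_i].

Definition finite_module (A : comNzRingType) (M : lmodType A) : Prop :=
  exists s : seq M, spanned s = setT.

Definition noetherian (A : comNzRingType) : Prop :=
  forall I : submodClosed A^o,
    exists s : seq A^o, [set x : A^o | x \in I] = spanned s.

Definition spec_closed (A : comNzRingType) (p : spec A) :
  set (spec A) := [set q : spec A | {subset p <= q}].

Definition supp (A : comNzRingType) (M : lmodType A) : set (spec A) :=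
  [set p : spec A | exists z : locmod p M, z != 0].

Definition min_supp (A : comNzRingType) (M : lmodType A) :
  set (spec A) :=
  [set p : spec A | supp M p /\
     forall q : spec A, supp M q -> {subset q <= p} -> q = p].

Definition ass (A : comNzRingType) (M : lmodType A) : set (spec A) :=
  [set p : spec A | exists x : M, forall a : A, (a \in p) = (a *: x == 0)].

(* the supremum of the empty set is -oo *)

Definition sup_nat (P : set nat) : \bar nat :=
  if `[< P = set0 >] then -oo%E
  else if `[< has_ubound P >] then (supremum 0%N P)%:E%E
  else +oo%E.

Definition prime_chain (A : comNzRingType) (n : nat)
    (c : 'I_n.+1 -> spec A) : Prop :=
  forall i j : 'I_n.+1, (i < j)%N ->
    {subset c i <= c j} /\ ~ {subset c j <= c i}.

Definition height (A : comNzRingType) (J : set A) : \bar nat :=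
  sup_nat [set n | exists c : 'I_n.+1 -> spec A,
                     prime_chain c /\ [set a : A | a \in c ord_max] = J].

(* ht (q / p), computed in the ring A / p; meant for p contained in q         *)
Definition quotient_height (A : comNzRingType) (q p : spec A) :
  \bar nat :=
  height [set \pi_{ideal_quot (spec_idealr p)} a | a in [set a : A | a \in q]].

Definition krull_dim (A : comNzRingType) (M : lmodType A) : \bar nat :=
  sup_nat [set n | exists c : 'I_n.+1 -> spec A,
                     prime_chain c /\ forall i, supp M (c i)].

Section RegularSequences.
Variables (A : comNzRingType) (M : lmodType A).

(* the submodule (s_0, ..., s_(k-1)) M *)
Definition seq_submod (s : seq A) : {pred M} := fun x =>
  `[< exists y : nat -> M, x = \sum_(i < size s) s`_i *: y i >].

Fact seq_submod_closed s : submod_closed (seq_submod s).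
Proof.
split.
  apply/asboolP; exists (fun=> 0).
  by rewrite big1 // => i _; rewrite scaler0.
move=> a x y /asboolP[f ->] /asboolP[g ->]; apply/asboolP.
exists (fun i => a *: f i + g i); rewrite scaler_sumr -big_split /=.
by apply: eq_bigr => i _; rewrite scalerDr !scalerA mulrC.
Qed.

HB.instance Definition _ s :=
  GRing.isSubmodClosed.Build A M (seq_submod s) (seq_submod_closed s).

Definition regular_element (N : lmodType A) (a : A) : Prop :=
  forall y : N, a *: y = 0 -> y = 0.

Definition regular_sequence (s : seq A) : Prop :=
  (forall i, (i < size s)%N ->
     regular_element (quotmod (seq_submod (take i s))) s`_i) /\
  exists y : quotmod (seq_submod s), y != 0.

Definition depth (I : set A) : \bar nat :=
  sup_nat [set n | exists s : seq A,
    [/\ size s = n, forall a, a \in s -> I a & regular_sequence s]].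

End RegularSequences.

(* in a local ring, the nonunits form the maximal ideal *)
Definition nonunits (A : comNzRingType) : set A :=
  [set a | forall b : A, b * a != 1].

(* for a module M over a local ring A; the zero module is Cohen-Macaulay *)
Definition cohen_macaulay (A : comNzRingType) (M : lmodType A) : Prop :=
  (forall x : M, x = 0) \/ depth M (@nonunits A) = krull_dim M.

Definition CM_locus (A : comNzRingType) (M : lmodType A) :
  set (spec A) :=
  [set p : spec A | @cohen_macaulay (locring p) (locmod p M)].

Definition equiheight_sets (A : comNzRingType) (M : lmodType A) :
  set (set (spec A)) :=
  [set T | T `<=` min_supp M /\
     exists2 q : spec A, supp M q &
       exists h : \bar nat, forall p, T p ->
         {subset p <= q} /\ quotient_height q p = h].

(* Main.v *)
Require Import Defs.
From HB Require Import structures.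
From mathcomp Require Import all_boot all_order all_algebra.
From mathcomp Require Import generic_quotient ring_quotient boolp classical_sets.
From mathcomp Require Import constructive_ereal ring.

Set Implicit Arguments.
Unset Strict Implicit.
Unset Printing Implicit Defensive.

Import GRing.Theory.
Local Open Scope classical_set_scope.
Local Open Scope ring_scope.
Local Open Scope quotient_scope.

(** Fix a prime q.  If no associated prime of M / N lies below q, then
    (M / N)_q = 0 ([ass_quotmod_avoid]), so N_q and M_q are isomorphic and one
    is Cohen-Macaulay exactly when the other is ([locmod_sub_cm]).  For
    N = M^T this is the inclusion from right to left.

    For the other inclusion, let q be in CM(M) and let T be the set of
    associated primes of M contained in q.  The same remark shows that q is in
    CM(M^T), so the point is that T belongs to S.  If M_q = 0, then T is
    empty.  Otherwise L = M_q is a nonzero Cohen-Macaulay module over the local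
    ring A_q, and two facts about an associated prime p of such an L suffice.

    First, a regular sequence of length n on L produces a chain of n + 1 primes
    starting at p ([regular_mod_chain]).  Hence depth L <= dim A_q/p <= dim L,
    all three are equal, and ht (q/p) = dim L does not depend on p
    ([cm_sup_eq_dim], [cm_point_height]).

    Second, p is minimal in the support: a chain of length dim L starts at p,
    and a smaller prime of the support would lengthen it ([cm_ass_min]).  This
    needs dim L to be finite, that is, a bound on the lengths of regular
    sequences ([regular_size_bounded]).  The bound is the number r of generators
    of the maximal ideal: a regular sequence of length n makes the Koszul
    cohomology on these generators vanish below degree n
    ([regular_koszul_acyclic]), and by Nakayama's lemma this forces n <= r
    ([koszul_acyclic_le]).

    Quotients M / N are handled inside M, by statements modulo N; thus the
    successive quotients by a regular sequence all live in one module. *)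

(** * Submodules and noetherian rings *)

Section Submodules.
Variables (A : comNzRingType) (M : lmodType A).

(** Membership is a proposition and not a boolean, so that kernels, sums and
    unions of chains are directly submodules. *)
Definition submodule (U : set M) : Prop :=
  U 0 /\ forall a x y, U x -> U y -> U (a *: x + y).

Section Closure.
Variables (U : set M) (sU : submodule U).

Lemma submodule0 : U 0. Proof. by case: sU. Qed.

Lemma submoduleD x y : U x -> U y -> U (x + y).
Proof. by case: sU => _ h Ux Uy; rewrite -[x]scale1r; exact: h. Qed.

Lemma submoduleZ a x : U x -> U (a *: x).
Proof. by case: sU => U0 h Ux; rewrite -[_ *: _]addr0; exact: h. Qed.

Lemma submoduleN x : U x -> U (- x).
Proof. by rewrite -scaleN1r; exact: submoduleZ. Qed.

Lemma submoduleB x y : U x -> U y -> U (x - y).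
Proof. by move=> Ux Uy; apply: submoduleD => //; exact: submoduleN. Qed.

End Closure.

Lemma submodule_closed (U : set M) : submodule U ->
  submod_closed (fun x => `[< U x >] : bool).
Proof.
case=> U0 h; split; first exact/asboolP.
by move=> a x y /asboolP Ux /asboolP Uy; apply/asboolP; exact: h.
Qed.

Lemma submodClosed_submodule (N : submodClosed M) :
  submodule [set x | x \in N].
Proof.
by split=> [|a x y Nx Ny]; [exact: rpred0 | apply: rpredD => //; exact: rpredZ].
Qed.

Lemma spanned_nil (y : M) : spanned [::] y <-> y = 0.
Proof.
split=> [[c ->]|->]; first by rewrite big_ord0.
by exists (fun=> 0); rewrite big_ord0.
Qed.

Lemma spanned_cons (x : M) s y :
  spanned (x :: s) y <-> exists a m, spanned s m /\ y = a *: x + m.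
Proof.
split=> [[c ->]|[a [m [[c ->] ->]]]].
  exists (c 0%N), (\sum_(i < size s) c i.+1 *: s`_i).
  by split; [exists (fun i => c i.+1) | rewrite big_ord_recl].
exists (fun i => if i is j.+1 then c j else a).
by rewrite big_ord_recl.
Qed.

Lemma spanned_submodule (s : seq M) : submodule (spanned s).
Proof.
split; first by exists (fun=> 0); rewrite big1 // => i _; rewrite scale0r.
move=> a x y [c ->] [e ->]; exists (fun i => a * c i + e i).
rewrite scaler_sumr -big_split; apply: eq_bigr => i _ /=.
by rewrite scalerDl scalerA.
Qed.

Lemma spanned_min (s : seq M) (U : set M) :
  submodule U -> (forall x, x \in s -> U x) -> spanned s `<=` U.
Proof.
move=> sU; elim: s => [_ y /spanned_nil ->|x s IHs h y]; first exact: submodule0.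
case/spanned_cons => a [m [sm ->]]; apply: submoduleD => //.
  by apply: submoduleZ => //; apply: h; rewrite mem_head.
by apply: IHs sm => z zs; apply: h; rewrite inE zs orbT.
Qed.

Lemma mem_spanned (s : seq M) x : x \in s -> spanned s x.
Proof.
elim: s => // y s IHs; rewrite inE => /orP[/eqP ->|xs]; apply/spanned_cons.
  by exists 1, 0; rewrite scale1r addr0; split=> //; case: (spanned_submodule s).
by exists 0, x; rewrite scale0r add0r; split=> //; exact: IHs.
Qed.

Lemma spanned_sub (s t : seq M) : {subset s <= t} -> spanned s `<=` spanned t.
Proof.
move=> st; apply: spanned_min; first exact: spanned_submodule.
by move=> x /st; exact: mem_spanned.
Qed.

End Submodules.

Section Noetherian.
Variables (A : comNzRingType) (hA : noetherian A).

Lemma ideal_fg (I : set A^o) : submodule I -> exists s, I = spanned s.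
Proof.
move=> sI.
pose h := GRing.isSubmodClosed.Build A A^o _ (submodule_closed sI).
pose J : submodClosed A^o := HB.pack (fun x => `[< I x >] : bool) h.
have [s sE] := hA J; exists s; rewrite -sE; apply/seteqP.
by split=> x; rewrite /= unfold_in => /asboolP.
Qed.

(** Induction on the number of generators of the ambient span: the
    coefficients of the first generator x in the elements of U form an ideal;
    lifts to U of generators of that ideal, together with generators of the
    part of U spanned by the other generators, generate U. *)
Lemma submodule_fg (M : lmodType A) (s : seq M) (U : set M) :
  submodule U -> U `<=` spanned s -> exists t, U = spanned t.
Proof.
elim: s U => [|x s IHs] U sU Us.
  exists [::]; apply/seteqP; split=> // y /spanned_nil ->; exact: submodule0.
have [|l lE] :=
  @ideal_fg [set a | exists2 m, spanned s m & U ((a : A) *: x + m)].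
  split; first by exists 0; [case: (spanned_submodule s) |
    rewrite scale0r addr0; exact: submodule0].
  move=> a b c [m sm Um] [n sn Un]; exists (a *: m + n).
    by case: (spanned_submodule s) => _; apply.
  rewrite scalerDl -scalerA addrACA -scalerDr.
  by case: sU => _; apply.
have [||t2 t2E] := IHs (U `&` spanned s); last first.
  (* t1 lifts the generators l of the ideal of leading coefficients. *)
  have [t1 [t1U t1h]] : exists t1 : seq M, spanned t1 `<=` U /\
      forall a, spanned l a ->
        exists2 m, spanned s m & spanned t1 ((a : A) *: x + m).
    have : forall b, b \in l -> exists2 m, spanned s m & U ((b : A) *: x + m).
      by move=> b bl; have := mem_spanned bl; rewrite -lE.
    elim: (l) => [|b l' IHl] h.
      exists [::]; split=> [y /spanned_nil ->|a /spanned_nil ->].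
        exact: submodule0.
      exists 0; first by case: (spanned_submodule s).
      by rewrite scale0r addr0; exact/spanned_nil.
    have [|t1 [t1U t1h]] := IHl; first by move=> c cl; apply: h; rewrite inE cl orbT.
    have [m sm Um] := h b (mem_head _ _); exists ((b : A) *: x + m :: t1); split.
      by move=> y /spanned_cons[c [n [/t1U Un ->]]]; case: sU => _; apply.
    move=> a /spanned_cons[c [e [/t1h[n sn tn] ->]]]; exists (c *: m + n).
      by case: (spanned_submodule s) => _; apply.
    apply/spanned_cons; exists c, ((e : A) *: x + n); split=> //.
    by rewrite scalerDl -scalerA addrACA -scalerDr.
  have sub1 : spanned t1 `<=` spanned (t1 ++ t2).
    by apply: spanned_sub => y yt; rewrite mem_cat yt.
  have sub2 : spanned t2 `<=` spanned (t1 ++ t2).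
    by apply: spanned_sub => y yt; rewrite mem_cat yt orbT.
  exists (t1 ++ t2); apply/seteqP; split=> y.
    move=> Uy; have /spanned_cons[a [m [sm ym]]] := Us _ Uy.
    have : spanned l (a : A^o) by rewrite -lE; exists m; rewrite -?ym.
    case/t1h => n sn tn; rewrite -[y](subrK ((a : A) *: x + n)).
    apply: submoduleD; [exact: spanned_submodule | apply: sub2 | exact: sub1].
    rewrite -t2E; split; first by apply: submoduleB => //; exact: t1U.
    rewrite ym opprD addrACA subrr add0r.
    by apply: submoduleB => //; exact: spanned_submodule.
  apply: spanned_min => // z; rewrite mem_cat => /orP[|] /mem_spanned.
    exact: t1U.
  by rewrite -t2E => -[].
- by move=> y [].
split; first by split; [exact: submodule0 | case: (spanned_submodule s)].
move=> a y z [Uy sy] [Uz sz].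
by split; [case: sU | case: (spanned_submodule s)] => _; apply.
Qed.

(** Zorn's lemma: the union of a chain of ideals is finitely generated, hence
    equal to a member of the chain. *)
Lemma ideal_maximal (F : set (set A^o)) (I0 : set A^o) :
  (forall I, F I -> submodule I) -> F I0 ->
  exists I, F I /\ forall J, F J -> I `<=` J -> J `<=` I.
Proof.
move=> Fsub FI0.
(* The empty set is added to the family to bound the empty chain. *)
have [G GF Gtot|I [[I0e|FI] Imax]] := @Zorn_bigcup A (fun I => I = set0 \/ F I).
- have [[I [GI [a Ia]]]|G0] := pselect (exists I, G I /\ exists a, I a);
    last first.
    left; apply/seteqP; split=> // a [I GI Ia].
    by apply: G0; exists I; split=> //; exists a.
  have GS J : G J -> (exists a, J a) -> submodule (J : set A^o).
    by move=> /GF[->[]//|/Fsub].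
  have common x y J K : G J -> J x -> G K -> K y -> exists L, [/\ G L, L x & L y].
    by move=> GJ Jx GK Ky; case: (Gtot J K GJ GK) => h; [exists K | exists J];
      split=> //; exact: h.
  have sU : submodule (\bigcup_(X in G) X : set A^o).
    split.
      by exists I => //; apply: (submodule0 (GS I GI _)); exists a.
    move=> b x y [J GJ Jx] [K GK Ky].
    have [L [GL Lx Ly]] := common x y J K GJ Jx GK Ky.
    by exists L => //; have [|_] := GS L GL; [exists x | apply].
  have [s sE] := ideal_fg sU; right; rewrite sE.
  have [J [GJ Ja sJ]] : exists J, [/\ G J, J a & forall x, x \in s -> J x].
    have : forall x, x \in s -> exists2 J, G J & J x.
      by move=> x /mem_spanned; rewrite -sE.
    elim: (s) => [|x s' IHs] h; first by exists I.
    have [J GJ Jx] := h x (mem_head _ _).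
    have [|K [GK Ka sK]] := IHs; first by move=> y ys; apply: h; rewrite inE ys orbT.
    have xs' (L : set A) : L x -> (forall y, y \in s' -> L y) ->
      forall y, y \in x :: s' -> L y.
      by move=> Lx Ls y; rewrite inE => /orP[/eqP ->|/Ls].
    case: (Gtot J K GJ GK) => JK; [exists K | exists J]; split=> //.
    - by apply: xs' => //; exact: JK.
    - exact: JK.
    - by apply: xs' => // y /sK/JK.
  have -> : spanned s = J.
    apply/seteqP; split; last by move=> x Jx; rewrite -sE; exists J.
    by apply: spanned_min => //; apply: GS => //; exists a.
  by case: (GF J GJ) => // J0; rewrite J0 in Ja.
- have I00 : I0 0 by apply: submodule0; exact: Fsub.
  case: (Imax I0); last by right.
  by rewrite I0e; split=> // /(_ _ I00).
- exists I; split=> // J FJ IJ.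
  case: (pselect (J `<=` I)) => // JI; case: (Imax J); last by right.
  by split.
Qed.

End Noetherian.

(** * Associated primes modulo a submodule *)

(** The associated primes of M / N. *)
Definition ass_mod (A : comNzRingType) (M : lmodType A) (N : set M) :
  set (spec A) :=
  [set p : spec A | exists x : M, forall a : A, a \in p <-> N (a *: x)].

Section AssociatedPrimes.
Variables (A : comNzRingType) (hA : noetherian A) (M : lmodType A).

(** Among the multiples y of x whose annihilator modulo N misses S, choose one
    with a maximal annihilator; this annihilator is prime.  Indeed, let a b
    kill y.  If the annihilator of b y misses S, it is no larger than that of
    y, so a kills y.  Otherwise some s in S kills b y; the annihilator of s y
    misses S, so it is no larger than that of y, and b kills y.

    With S = {1} this gives an associated prime of any nonzero module; with S
    the complement of a prime q, it gives one below q as soon as the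
    localization at q is nonzero. *)
Lemma ass_mod_exists (N : set M) (S : set A) (x : M) :
  submodule N -> S 1 -> (forall s t, S s -> S t -> S (s * t)) ->
  (forall s, S s -> ~ N (s *: x)) ->
  exists p : spec A, [/\ ass_mod N p, forall a, N (a *: x) -> a \in p &
    forall s, S s -> s \notin p].
Proof.
move=> sN S1 SM Sx.
pose ann (y : M) : set A^o := [set a : A^o | N ((a : A) *: y)].
have annS y : submodule (ann y).
  split; first by rewrite /ann /= scale0r; exact: submodule0.
  move=> a b c; rewrite /ann /= => Nb Nc; rewrite scalerDl -scalerA.
  by case: sN => _; apply.
pose F : set (set A^o) := [set I | exists c : A,
  (forall s, S s -> ~ N (s *: (c *: x))) /\ I = ann (c *: x)].
have [||_ [[c [Sc ->]] cmax]] := @ideal_maximal A hA F (ann x).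
- by move=> I [c [_ ->]]; exact: annS.
- by exists 1; rewrite scale1r.
set y := c *: x in Sc cmax *.
(* Maximality: no multiple d y admissible for S has new annihilators. *)
have mem d a : (forall s, S s -> ~ N (s *: (d *: y))) ->
    N (a *: (d *: y)) -> N (a *: y).
  move=> Sd Nd; apply: (cmax (ann (d *: y))) => //.
    by exists (d * c); rewrite -scalerA; split.
  move=> e; rewrite /ann /= => Ne; rewrite scalerA mulrC -scalerA.
  exact: submoduleZ.
pose P a : bool := `[< N (a *: y) >].
have PI : idealr_closed P.
  split; first by apply/asboolP; rewrite scale0r; exact: submodule0.
    by apply/asboolP; exact: Sc.
  move=> a u v /asboolP Nu /asboolP Nv; apply/asboolP.
  by rewrite scalerDl -scalerA; case: sN => _; apply.
have PP : prime_idealr_closed P.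
  move=> a b /asboolP Nab; apply/orP.
  case: (pselect (forall s, S s -> ~ N (s *: (b *: y)))) => [Sb|].
    by left; apply/asboolP; apply: (mem b) => //; rewrite scalerA.
  move/existsNP => [s] /not_implyP[Ss] /contrapT Nsb.
  right; apply/asboolP; apply: (mem s); last by rewrite scalerA mulrC -scalerA.
  by move=> t St; rewrite scalerA; apply: Sc; exact: SM.
exists (Spec PI PP); split.
- by exists y => a; split=> [/asboolP|Na] //; exact/asboolP.
- move=> a Na; apply/asboolP; rewrite /y scalerA mulrC -scalerA.
  exact: submoduleZ.
- by move=> s Ss; apply/asboolP; exact: Sc.
Qed.

End AssociatedPrimes.

(** * Nakayama's lemma and chains of primes over a local ring *)

Definition local_ring (A : comNzRingType) : Prop :=
  forall a b : A, nonunits a -> nonunits b -> nonunits (a + b).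

(** N + x M, the preimage in M of x (M / N). *)
Definition add_mul (A : comNzRingType) (M : lmodType A) (N : set M) (x : A) :
  set M := [set z | exists n y, N n /\ z = n + x *: y].

Lemma add_mul_submodule (A : comNzRingType) (M : lmodType A) (N : set M) x :
  submodule N -> submodule (add_mul N x).
Proof.
move=> sN; split.
  by exists 0, 0; rewrite scaler0 addr0; split=> //; exact: submodule0.
move=> a _ _ [n [y [Nn ->]]] [m [z [Nm ->]]].
exists (a *: n + m), (a *: y + z); split; first by case: sN => _; apply.
by rewrite !scalerDr addrACA !scalerA [a * x]mulrC.
Qed.

Section Local.
Variables (A : comNzRingType) (hA : noetherian A) (locA : local_ring A).

Lemma nonunitM (a b : A) : nonunits a -> nonunits (b * a).
Proof. by move=> na c; rewrite mulrA; exact: na. Qed.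

Lemma local_unit (a b : A) : nonunits a -> exists c, c * (1 - b * a) = 1.
Proof.
move=> na; apply: contrapT => /forallNP h.
have /(_ 1) : nonunits ((1 - b * a) + b * a).
  by apply: locA; [move=> c; apply/eqP; exact: h | exact: nonunitM].
by rewrite subrK mulr1 eqxx.
Qed.

(** The generators of U are removed one at a time.  Modulo N and the remaining
    generators, the generator y under consideration equals a x y for some a;
    since 1 - a x is a unit, y can be removed. *)
Lemma nakayama (M : lmodType A) (s : seq M) (U N : set M) (x : A) :
  submodule U -> submodule N -> U `<=` spanned s -> nonunits x ->
  (forall u, U u -> exists n v, [/\ N n, U v & u = n + x *: v]) -> U `<=` N.
Proof.
move=> sU sN Us nx h; have [t tE] := submodule_fg hA sU Us.
pose W (r : seq M) := [set z | exists n u, [/\ N n, spanned r u & z = n + u]].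
have sW r : submodule (W r).
  split.
    by exists 0, 0; rewrite addr0; split=> //;
      [exact: submodule0 | case: (spanned_submodule r)].
  move=> a _ _ [n [u [Nn ru ->]]] [m [v [Nm rv ->]]].
  exists (a *: n + m), (a *: u + v); split; first by case: sN => _; apply.
    by case: (spanned_submodule r) => _; apply.
  by rewrite scalerDr addrACA.
have NW r : N `<=` W r.
  move=> n Nn; exists n, 0; rewrite addr0; split=> //.
  by case: (spanned_submodule r).
have : exists2 r, (forall y, y \in r -> U y) & U `<=` W r.
  exists t => [y|u]; rewrite tE; first exact: mem_spanned.
  move=> tu; exists 0, u; rewrite add0r.
  by split=> //; exact: submodule0.
case=> r; elim: r => [_|y r IHr rU] Ur.
  by move=> u /Ur[n [_ [Nn /spanned_nil -> ->]]]; rewrite addr0.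
apply: IHr => [z zr|u /Ur]; first by apply: rU; rewrite inE zr orbT.
have [n [v [Nn Uv yE]]] := h y (rU y (mem_head _ _)).
have [m [_ [Nm /spanned_cons[a [k [rk ->]]] vE]]] := Ur v Uv.
have Wy : W r y.
  have [c c1] := local_unit a nx.
  have : W r (n + x *: (m + k)).
    exists (n + x *: m), (x *: k); split.
    - by apply: submoduleD => //; exact: submoduleZ.
    - by apply: submoduleZ => //; exact: spanned_submodule.
    - by rewrite scalerDr addrA.
  have -> : n + x *: (m + k) = (1 - a * x) *: y.
    have yE' : y = n + x *: (m + k) + (a * x) *: y.
      rewrite {1}yE vE addrCA scalerDr scalerA [x * a]mulrC addrCA.
      exact: addrC.
    by rewrite scalerBl scale1r {1}yE' addrK.
  by move/(submoduleZ (sW r) c); rewrite scalerA c1 scale1r.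
case=> e [_ [Ne /spanned_cons[b [l [rl ->]]] ->]].
rewrite addrCA; apply: submoduleD => //; first exact: submoduleZ.
by exists e, l.
Qed.

(** Weakly regular sequences on M / N: dividing M / N by x amounts to
    replacing N by N + x M. *)
Fixpoint regular_mod (M : lmodType A) (N : set M) (s : seq A) : Prop :=
  if s is x :: s' then
    (forall y, N (x *: y) -> N y) /\ regular_mod (add_mul N x) s'
  else True.

Definition spec_lt (p q : spec A) : Prop :=
  {subset p <= q} /\ ~ {subset q <= p}.

Lemma prime_chain_cons n (p : spec A) (c : 'I_n.+1 -> spec A) :
  spec_lt p (c ord0) -> prime_chain c ->
  exists c' : 'I_n.+2 -> spec A, [/\ prime_chain c', c' ord0 = p &
    forall i, c' (lift ord0 i) = c i].
Proof.
move=> pc cc.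
exists (fun i => if unlift ord0 i is Some j then c j else p).
split; [|by rewrite unlift_none|by move=> i; rewrite liftK].
move=> i j; case: unliftP => [i' ->|->]; case: unliftP => [j' ->|->] //=.
  by rewrite /bump /= !add1n ltnS => /cc.
case: (posnP j') => [j0 _|j0 _].
  by have -> : j' = ord0 by exact: val_inj.
have [h1 h2] := cc ord0 j' j0; have [h3 h4] := pc.
by split=> [x /h3/h1|h] //; apply: h2 => x /h/h3.
Qed.

(** Let x be the first element of the sequence and U the set of elements of M
    killed by p modulo N.  If U were contained in N + x M, regularity of x
    would give U = N + x U, and U would be N by Nakayama's lemma, although p is
    associated to M / N.  So some y in U is nonzero modulo N + x M, and there is
    an associated prime of M / (N + x M) containing the annihilator of y, thus
    containing p and x.  It is strictly larger than p, because x is a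
    nonzerodivisor on M / N.  The induction continues from this prime. *)
Lemma regular_mod_chain (M : lmodType A) (g : seq M) (N : set M) (s : seq A)
    (p : spec A) :
  spanned g = setT -> submodule N -> ass_mod N p ->
  (forall x, x \in s -> nonunits x) -> regular_mod N s ->
  exists c : 'I_(size s).+1 -> spec A, prime_chain c /\ c ord0 = p.
Proof.
move=> gT; elim: s N p => [|x s IHs] N p sN [z pz] ns /=.
  by exists (fun=> p); split=> // i j; rewrite !ord1.
case=> xreg sreg; have sN' := add_mul_submodule x sN.
pose U : set M := [set u | forall a, a \in p -> N (a *: u)].
have sU : submodule U.
  split=> [a _|b u v Uu Uv a ap]; first by rewrite scaler0; exact: submodule0.
  rewrite scalerDr scalerA mulrC -scalerA.
  by case: sN => _; apply; [exact: Uu | exact: Uv].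
have p1 : 1 \notin p by rewrite (idealr1 (spec_idealr p)).
have [y [Uy Ny]] : exists y, U y /\ ~ add_mul N x y.
  apply: contrapT => /forallNP h; case/negP: p1; apply/pz; rewrite scale1r.
  suff: U `<=` N by apply=> a /pz.
  apply: (@nakayama M g _ _ x) => //.
  - by rewrite gT.
  - by apply: ns; rewrite mem_head.
  move=> u Uu; have /not_andP[//|/contrapT[n [v [Nn uE]]]] := h u.
  exists n, v; split=> // a ap; apply: xreg.
  rewrite scalerA mulrC -scalerA -[X in N X](addKr (a *: n)).
  rewrite addrC -scalerDr -uE; apply: submoduleB => //; first exact: Uu.
  exact: submoduleZ.
have [||q [Nq yq _]] :=
    @ass_mod_exists A hA M (add_mul N x) [set 1] y sN' erefl.
- by move=> a b -> ->; rewrite mul1r.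
- by move=> s1 ->; rewrite scale1r.
have [|c [cc c0]] := IHs _ q sN' Nq _ sreg.
  by move=> a sa; apply: ns; rewrite inE sa orbT.
have NN' : N `<=` add_mul N x.
  by move=> n Nn; exists n, 0; rewrite scaler0 addr0.
have pq : spec_lt p q.
  split=> [a ap|qp]; first by apply: yq; apply: NN'; exact: Uy.
  have : x \in p.
    apply: qp; apply: yq; exists 0, y; rewrite add0r; split=> //.
    exact: submodule0.
  by move=> /pz/xreg Nz; case/negP: p1; apply/pz; rewrite scale1r.
rewrite -c0 in pq.
by have [c' [cc' c0' _]] := prime_chain_cons pq cc; exists c'.
Qed.

End Local.

(** * Koszul cohomology bounds the length of regular sequences *)

Section Koszul.
Variables (A : comNzRingType) (M : lmodType A) (a : nat -> A).

(** The Koszul complex on a 0, ..., a (r - 1), all degrees together, built as an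
    iterated mapping cone: in a pair (u, v) homogeneous of degree i, the
    component u has degree i and v has degree i - 1. *)
Fixpoint koszul (r : nat) : lmodType A :=
  if r is r'.+1 then (koszul r' * koszul r')%type : lmodType A else M.

#[local] Arguments koszul : simpl never.

Fixpoint koszul_d (r : nat) : koszul r -> koszul r :=
  match r return koszul r -> koszul r with
  | 0 => fun=> 0
  | r'.+1 => fun z => (koszul_d z.1, a r' *: z.1 - koszul_d z.2)
  end.

(** Contraction with c, the homotopy between 0 and multiplication by the
    combination of the a i with coefficients c i. *)
Fixpoint koszul_h (c : nat -> A) (r : nat) : koszul r -> koszul r :=
  match r return koszul r -> koszul r with
  | 0 => fun=> 0
  | r'.+1 => fun z => (koszul_h c z.1 + c r' *: z.2, - koszul_h c z.2)
  end.

(** The cochains that vanish in the Koszul complex of M / N. *)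
Fixpoint koszul_in (N : set M) (r : nat) : set (koszul r) :=
  match r return set (koszul r) with
  | 0 => N
  | r'.+1 => fun z => koszul_in N z.1 /\ koszul_in N z.2
  end.

(** The cochains all of whose components have degree < n.  The truncation in
    n.-1 is harmless: only 0 has all its components in degrees < 0. *)
Fixpoint koszul_lt (r n : nat) : set (koszul r) :=
  match r return set (koszul r) with
  | 0 => fun z => n = 0%N -> z = 0
  | r'.+1 => fun z => koszul_lt n z.1 /\ koszul_lt n.-1 z.2
  end.

Let pairE (L : lmodType A) b (x y u v : L) :
  b *: (x, y) + (u, v) = (b *: x + u, b *: y + v).
Proof. by []. Qed.

Lemma koszul_d_linear r b (z w : koszul r) :
  koszul_d (b *: z + w) = b *: koszul_d z + koszul_d w.
Proof.
elim: r z w => [|r IHr]; first by move=> z w; rewrite /= scaler0 addr0.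
case=> z z' [w w']; rewrite pairE /= pairE !IHr; congr pair.
by rewrite scalerBr scalerDr opprD addrACA !scalerA [b * _]mulrC.
Qed.

Lemma koszul_h_linear c r b (z w : koszul r) :
  koszul_h c (b *: z + w) = b *: koszul_h c z + koszul_h c w.
Proof.
elim: r z w => [|r IHr]; first by move=> z w; rewrite /= scaler0 addr0.
case=> z z' [w w']; rewrite pairE /= pairE !IHr; congr pair.
  by rewrite !scalerDr addrACA !scalerA mulrC.
by rewrite opprD scalerN.
Qed.

HB.instance Definition _ r :=
  GRing.isLinear.Build A (koszul r) (koszul r) *:%R
    (@koszul_d r) (@koszul_d_linear r).
HB.instance Definition _ c r :=
  GRing.isLinear.Build A (koszul r) (koszul r) *:%R
    (@koszul_h c r) (@koszul_h_linear c r).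

Lemma koszul_dd r (z : koszul r) : koszul_d (koszul_d z) = 0.
Proof.
elim: r z => [|r IHr] //= [u v] /=.
rewrite linearB linearZ /= !IHr. by rewrite (subr0 (_ : koszul r)) subrr.
Qed.

(** Consequently every element of the ideal generated by the a i kills the
    Koszul cohomology. *)
Lemma koszul_homotopy c r (z : koszul r) :
  koszul_h c (koszul_d z) + koszul_d (koszul_h c z) =
  (\sum_(i < r) c i * a i) *: z.
Proof.
elim: r z => [|r IHr]; first by move=> z; rewrite big_ord0 scale0r /= addr0.
case=> u v; rewrite big_ord_recr /=.
rewrite !linearD !linearN /= !linearZ /= !scalerN !opprK.
apply: (congr2 pair); rewrite /= scalerDl -IHr !scalerA.
  by rewrite addrACA subrK mulrC.
by rewrite addrACA addKr addrC.
Qed.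

Lemma koszul_in_submodule N r : submodule N -> submodule (@koszul_in N r).
Proof.
move=> sN; elim: r => // r IHr; split.
  by split; exact: submodule0.
by move=> b [x x'] [y y'] [? ?] [? ?]; split; case: IHr => _; apply.
Qed.

Lemma koszul_lt_submodule r n : submodule (@koszul_lt r n).
Proof.
elim: r n => [|r IHr] n.
  by split=> // b x y hx hy n0; rewrite hx // hy // scaler0 addr0.
split; first by split; exact: submodule0.
move=> b [x x'] [y y'] [/= h1 h2] [/= h3 h4].
by split; [case: (IHr n) | case: (IHr n.-1)] => _; apply.
Qed.

Lemma koszul_in_d N r (z : koszul r) : submodule N ->
  koszul_in N z -> koszul_in N (koszul_d z).
Proof.
move=> sN; elim: r z => [|r IHr] /=; first by move=> *; exact: submodule0.
case=> u v [/= Nu Nv]; split; first exact: IHr.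
have sNr := koszul_in_submodule r sN.
by apply: submoduleB => //; [exact: submoduleZ | exact: IHr].
Qed.

Lemma koszul_in_h c N r (z : koszul r) : submodule N ->
  koszul_in N z -> koszul_in N (koszul_h c z).
Proof.
move=> sN; elim: r z => [|r IHr] /=; first by move=> *; exact: submodule0.
case=> u v [/= Nu Nv]; have sNr := koszul_in_submodule r sN; split.
  by apply: submoduleD => //; [exact: IHr | exact: submoduleZ].
by apply: submoduleN => //; exact: IHr.
Qed.

Lemma koszul_in_sub N N' r (z : koszul r) :
  N `<=` N' -> koszul_in N z -> koszul_in N' z.
Proof.
move=> NN'; elim: r z => [|r IHr] /=; first exact: NN'.
by case=> u v [/= Nu Nv]; split; exact: IHr.
Qed.

Lemma koszul_lt_d r n (z : koszul r) :
  koszul_lt n.-1 z -> koszul_lt n (koszul_d z).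
Proof.
elim: r n z => [|r IHr] n //= [u v] [/= hu hv]; split; first exact: IHr.
apply: submoduleB; [exact: koszul_lt_submodule | | exact: IHr].
by apply: submoduleZ => //; exact: koszul_lt_submodule.
Qed.

Lemma koszul_lt_h c r n (z : koszul r) :
  koszul_lt n z -> koszul_lt n.-1 (koszul_h c z).
Proof.
elim: r n z => [|r IHr] n //= [u v] [/= hu hv]; split.
  apply: submoduleD; [exact: koszul_lt_submodule | exact: IHr|].
  by apply: submoduleZ => //; exact: koszul_lt_submodule.
by apply: submoduleN; [exact: koszul_lt_submodule | exact: IHr].
Qed.

Lemma koszul_lt0 r (z : koszul r) : koszul_lt 0 z -> z = 0.
Proof.
by elim: r z => [z ->//|r IHr] [u v] [/= /IHr -> /IHr ->].
Qed.

Lemma koszul_in_reg N x r (z : koszul r) :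
  (forall y, N (x *: y) -> N y) -> koszul_in N (x *: z) -> koszul_in N z.
Proof.
move=> h; elim: r z => [|r IHr] /=; first exact: h.
by case=> u v [/= Nu Nv]; split; exact: IHr.
Qed.

Lemma koszul_in_add_mul N x r n (z : koszul r) : submodule N ->
  koszul_in (add_mul N x) z -> koszul_lt n z ->
  exists u v, [/\ koszul_in N u, koszul_lt n v & z = u + x *: v].
Proof.
move=> sN; elim: r n z => [|r IHr] n /=.
  move=> z [u [v [Nu ->]]] hz; case: (posnP n) => [n0|n0].
    exists 0, 0; rewrite scaler0 addr0 hz //.
    by split=> //; exact: submodule0.
  by exists u, v; split=> // nE; rewrite nE in n0.
case=> z z' [/= Nz Nz'] [/= hz hz'].
have [u [v [Nu hv zE]]] := IHr _ _ Nz hz.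
have [u' [v' [Nu' hv' z'E]]] := IHr _ _ Nz' hz'.
by exists (u, u'), (v, v'); split=> //; rewrite zE z'E.
Qed.

(** The cohomology with coefficients in M / N vanishes in degrees < n; as the
    differential raises degrees by 1, the cochain w may be cut to
    degrees < n - 1. *)
Definition koszul_acyclic (N : set M) r n : Prop :=
  forall z : koszul r, koszul_lt n z -> koszul_in N (koszul_d z) ->
    exists w : koszul r, koszul_lt n.-1 w /\ koszul_in N (z - koszul_d w).

(** Let x be the first element of the sequence.  Given a cocycle z of degree
    < n + 1, the homotopy gives x z = d w with w of degree < n.  Modulo N + x M,
    w is a cocycle, hence w = d u + x v modulo N by induction.  Then
    x z = x (d v), and z = d v modulo N because x is regular. *)
Lemma regular_koszul_acyclic (N : set M) r (s : seq A) : submodule N ->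
  (forall x, x \in s -> exists c : nat -> A, x = \sum_(i < r) c i * a i) ->
  regular_mod N s -> koszul_acyclic N r (size s).
Proof.
elim: s N => [|x s IHs] N sN sa.
  move=> _ z /koszul_lt0 -> _; exists 0; rewrite linear0 subr0.
  split; apply: submodule0; first exact: koszul_lt_submodule.
  exact: koszul_in_submodule.
case=> xreg sreg z hz Nz.
have sN' := add_mul_submodule x sN.
have [c xE] := sa x (mem_head _ _).
have /= xz := koszul_homotopy c z; rewrite -xE in xz.
have Nr := koszul_in_submodule r sN.
set w := koszul_h c z in xz.
have hw : koszul_lt (size s) w by exact: (koszul_lt_h c hz).
have NN' : N `<=` add_mul N x.
  by move=> n Nn; exists n, 0; rewrite scaler0 addr0.
have mulN' r' (y : koszul r') : koszul_in (add_mul N x) (x *: y).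
  elim: r' y => [y|r' IHr'] /=; last by case=> u v; split; exact: IHr'.
  by exists 0, y; rewrite add0r; split=> //; exact: submodule0.
have N'r := koszul_in_submodule r sN'.
have dwE : koszul_d w = x *: z - koszul_h c (koszul_d z).
  by rewrite -xz addrC addKr.
have [||u [hu wu]] := IHs _ sN' _ sreg w hw.
- by move=> y ys; apply: sa; rewrite inE ys orbT.
- rewrite dwE; apply: submoduleB => //; apply: (koszul_in_sub NN').
  exact: koszul_in_h.
have [|n [v [Nn hv wE]]] := @koszul_in_add_mul _ _ _ (size s) _ sN wu.
  by apply: submoduleB => //; [exact: koszul_lt_submodule | exact: koszul_lt_d].
exists v; split=> //; apply: (koszul_in_reg xreg).
have -> : x *: (z - koszul_d v) = koszul_h c (koszul_d z) + koszul_d n.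
  have e : koszul_d w = koszul_d n + x *: koszul_d v.
    have := congr1 (@koszul_d r) wE; rewrite linearB /= koszul_dd subr0 => ->.
    by rewrite linearD linearZ.
  by rewrite scalerBr -xz -/w e addrA addrK.
by apply: submoduleD => //; [exact: koszul_in_h | exact: koszul_in_d].
Qed.

Lemma koszul_finite r : finite_module M -> finite_module (koszul r).
Proof.
move=> hM; elim: r => // r [s sT].
exists ([seq (x, 0) | x <- s] ++ [seq (0, x) | x <- s]).
set t := _ ++ _; apply/seteqP; split=> // -[u v] _.
have st := spanned_submodule t.
have hu : spanned t (u, 0).
  have : spanned s u by rewrite sT.
  apply: (@spanned_min _ _ s [set u | spanned t (u, 0)]) => [|x xs].
    split; first exact: submodule0 st.
    move=> b x y hx hy; have [_ /(_ b _ _ hx hy)] := st.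
    by rewrite pairE scaler0 addr0.
  by apply: mem_spanned; rewrite mem_cat map_f.
have hv : spanned t (0, v).
  have : spanned s v by rewrite sT.
  apply: (@spanned_min _ _ s [set v | spanned t (0, v)]) => [|x xs].
    split; first exact: (submodule0 st).
    move=> b x y hx hy; have [_ /(_ b _ _ hx hy)] := st.
    by rewrite pairE scaler0 addr0.
  by apply: mem_spanned; rewrite mem_cat map_f ?orbT.
have -> : (u, v) = 1 *: (u, 0) + (0, v).
  by rewrite pairE scale1r scaler0 addr0 add0r.
by case: st => _; apply.
Qed.

(** Removing the last element a r costs one degree.  If z is a cocycle of the
    complex on r elements, then (0, z) is a cocycle of the complex on r + 1
    elements, hence the coboundary of some (v, w), which says that v is a
    cocycle and z = a r v - d w.  So the cohomology H satisfies H = a r H and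
    vanishes by Nakayama's lemma.  Once no element is left, the cohomology is
    M / N, in degree 0, and it is nonzero. *)
Lemma koszul_acyclic_le (hA : noetherian A) (locA : local_ring A) (N : set M) r n :
  finite_module M -> (forall i, nonunits (a i)) ->
  submodule N -> (exists y, ~ N y) -> koszul_acyclic N r n -> (n <= r)%N.
Proof.
move=> hM na sN [y Ny]; elim: r n => [|r IHr] n acN.
  rewrite leqNgt; apply/negP => n0; apply: Ny.
  have [||w [_ /=]] := acN y; first by move=> n0'; rewrite n0' in n0.
    exact: submodule0.
  by rewrite subr0.
case: n acN => // n acN; rewrite ltnS; apply: IHr => z hz Nz.
have Nr := koszul_in_submodule r sN.
pose Z : set (koszul r) := [set z | koszul_lt n z /\ koszul_in N (koszul_d z)].
pose B : set (koszul r) :=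
  [set z | exists w : koszul r, koszul_lt n.-1 w /\ koszul_in N (z - koszul_d w)].
have sZ : submodule Z.
  split; first by split; rewrite ?linear0; apply: submodule0 => //;
    exact: koszul_lt_submodule.
  move=> b u v [hu Nu] [hv Nv]; split.
    by case: (koszul_lt_submodule r n) => _; apply.
  by rewrite linearP; case: Nr => _; apply.
have sB : submodule B.
  split.
    exists 0; rewrite linear0 subr0; split; apply: submodule0 => //.
    exact: koszul_lt_submodule.
  move=> b u v [w [hw Nw]] [w' [hw' Nw']]; exists (b *: w + w'); split.
    by case: (koszul_lt_submodule r n.-1) => _; apply.
  have -> : b *: u + v - koszul_d (b *: w + w') =
      b *: (u - koszul_d w) + (v - koszul_d w').
    by rewrite linearP scalerBr opprD addrACA.
  by case: Nr => _; apply.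
have [s sT] := koszul_finite r hM.
apply: (@nakayama A hA locA _ s Z B (a r)) => //; first by rewrite sT.
move=> u [hu Nu]; have [||[v w] [[/= hv hw] [/= Nv Nw]]] := acN ((0 : koszul r), u).
- by split=> //; exact: submodule0 (koszul_lt_submodule _ _).
- split=> /=; rewrite linear0 ?scaler0 ?sub0r; first exact: submodule0.
  exact: submoduleN.
rewrite sub0r in Nv.
exists (u - a r *: v), v; split; last by rewrite subrK.
  exists (- w); split; first by apply: submoduleN => //; exact: koszul_lt_submodule.
  by rewrite linearN opprK; move: Nw; rewrite opprB addrA addrAC.
by split=> //; rewrite -[koszul_d v]opprK; exact: submoduleN.
Qed.

End Koszul.

(** The bound r is the number of generators of the maximal ideal.  This plays
    the role of Krull's height theorem. *)
Lemma regular_size_bounded (A : comNzRingType) (M : lmodType A) (N : set M) :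
  noetherian A -> local_ring A -> finite_module M ->
  submodule N -> (exists y, ~ N y) ->
  exists r, forall s : seq A,
    (forall x, x \in s -> nonunits x) -> regular_mod N s -> (size s <= r)%N.
Proof.
move=> hA locA hM sN NM.
have [|t tE] := @ideal_fg A hA (@nonunits A).
  split; first by move=> b; rewrite mulr0 eq_sym oner_neq0.
  by move=> b x y hx hy; apply: locA => //; exact: nonunitM.
exists (size t) => s hs sreg.
apply: (@koszul_acyclic_le A M (nth 0 t) hA locA N) => //.
  move=> i; case: (ltnP i (size t)) => ti.
    by rewrite tE; apply: mem_spanned; exact: mem_nth.
  by rewrite nth_default //; move=> b; rewrite mulr0 eq_sym oner_neq0.
apply: regular_koszul_acyclic => // x /hs; rewrite tE => -[c ->].
by exists c.
Qed.

(** * Associated primes, supports and regular sequences inside a module *)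

Section Translation.
Variables (A : comNzRingType) (M : lmodType A).

Lemma pi_quotmod_eq0 (N : submodClosed M) (x : M) :
  \pi_(quotmod N) x = 0 <-> x \in N.
Proof.
have p0 : \pi_(quotmod N) 0 = 0.
  by apply: (addrI (\pi_(quotmod N) 0)); rewrite -pi_quotmodD !addr0.
split=> [|xN]; first by rewrite -p0 => /quotmodP; rewrite subr0.
by rewrite -p0; apply/quotmodP; rewrite subr0.
Qed.

Lemma pi_quotmodZ (N : submodClosed M) a (x : M) :
  a *: \pi_(quotmod N) x = \pi_(quotmod N) (a *: x).
Proof. exact: pi_quotmod_scale. Qed.

Lemma assE : ass M = ass_mod [set 0 : M].
Proof.
apply/seteqP; split=> p [x h]; exists x => a.
  by rewrite h; split=> /eqP.
by apply/idP/eqP => /h.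
Qed.

Lemma ass_quotmod (N : submodClosed M) :
  ass (quotmod N) = ass_mod [set x | x \in N].
Proof.
apply/seteqP; split=> p [].
  elim/quotmodW => x h; exists x => a; rewrite h pi_quotmodZ.
  by split=> [/eqP/pi_quotmod_eq0|/pi_quotmod_eq0 ->].
move=> x h; exists (\pi_(quotmod N) x) => a; rewrite pi_quotmodZ.
by apply/idP/eqP => [/h/pi_quotmod_eq0|/pi_quotmod_eq0/h].
Qed.

Lemma set0_submodule : submodule [set 0 : M].
Proof. by split=> // a x y -> ->; rewrite scaler0 addr0. Qed.

Lemma loc_frac0P (p : spec A) (x : M) (s : denom p) :
  loc_frac x s = 0 <-> exists2 t, t \notin p & t *: x = 0.
Proof.
rewrite -[0]/(loc_frac 0 (denom1 p)); split=> [/loc_frac_eqP[u]|[t tp tx]].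
  by rewrite scaler0 => ux; exists (val u * val (denom1 p)) => //;
    exact: (valP (denomM u (denom1 p))).
apply/loc_frac_eqP; exists (exist (fun s => s \notin p) t tp).
by rewrite scaler0 /= mulr1.
Qed.

Lemma suppP (p : spec A) :
  supp M p <-> exists x : M, forall a : A, a *: x = 0 -> a \in p.
Proof.
split=> [[z]|[x h]].
  elim/loc_fracW: z => x s /eqP h; exists x => a ax.
  by apply: contrapT => /negP ap; apply: h; apply/loc_frac0P; exists a.
exists (loc_frac x (denom1 p)); apply/eqP => /loc_frac0P[t tp /h].
by move/negP: tp.
Qed.

Lemma ass_supp : ass M `<=` supp M.
Proof. by move=> p [x h]; apply/suppP; exists x => a ax; rewrite h ax. Qed.

Lemma supp_le (p q : spec A) : {subset p <= q} -> supp M p -> supp M q.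
Proof. by move=> pq /suppP[x h]; apply/suppP; exists x => a /h/pq. Qed.

Definition seq_span (s : seq A) : set M := [set x | x \in @seq_submod A M s].

Lemma seq_spanP s x :
  seq_span s x <-> exists y : nat -> M, x = \sum_(i < size s) s`_i *: y i.
Proof.
by rewrite /seq_span /= unfold_in; split=> [/asboolP|h]; [|apply/asboolP].
Qed.

Lemma seq_span_nil : seq_span [::] = [set 0].
Proof.
apply/seteqP; split=> x; first by case/seq_spanP => y ->; rewrite big_ord0.
by move=> ->; apply/seq_spanP; exists (fun=> 0); rewrite big_ord0.
Qed.

Lemma seq_span_rcons s a : seq_span (rcons s a) = add_mul (seq_span s) a.
Proof.
apply/seteqP; split=> x.
  case/seq_spanP => y ->; rewrite size_rcons big_ord_recr /=.
  exists (\sum_(i < size s) s`_i *: y i), (y (size s)); split.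
    by apply/seq_spanP; exists y.
  rewrite nth_rcons ltnn eqxx; congr (_ + _); apply: eq_bigr => i _.
  by rewrite nth_rcons ltn_ord.
case=> n [y [/seq_spanP[w ->] ->]]; apply/seq_spanP.
exists (fun i => if (i < size s)%N then w i else y).
rewrite size_rcons big_ord_recr /= nth_rcons ltnn eqxx; congr (_ + _).
by apply: eq_bigr => i _; rewrite nth_rcons ltn_ord.
Qed.

Lemma regular_sequenceP s : regular_sequence M s <->
  (forall i, (i < size s)%N -> forall y : M,
     seq_span (take i s) (s`_i *: y) -> seq_span (take i s) y) /\
  exists y, ~ seq_span s y.
Proof.
split=> -[h [y hy]]; split.
- move=> i si z hz; apply/pi_quotmod_eq0; apply: (h i si).
  by rewrite pi_quotmodZ; apply/pi_quotmod_eq0.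
- elim/quotmodW: y hy => y /eqP hy; exists y => ys; apply: hy.
  exact/pi_quotmod_eq0.
- move=> i si; elim/quotmodW => z; rewrite pi_quotmodZ => /pi_quotmod_eq0 hz.
  by apply/pi_quotmod_eq0; exact: h.
- by exists (\pi_(quotmod (@seq_submod A M s)) y); apply/eqP => /pi_quotmod_eq0.
Qed.

Lemma regular_sequence_mod s : regular_sequence M s -> regular_mod [set 0 : M] s.
Proof.
move=> /regular_sequenceP[h _]; rewrite -seq_span_nil.
have {}h : forall i, (i < size s)%N -> forall y : M,
    seq_span ([::] ++ take i s) (s`_i *: y) -> seq_span ([::] ++ take i s) y.
  exact: h.
elim: s [::] h => //= x s IHs l h; split.
  by move=> y; have := h 0%N isT y; rewrite cats0.
rewrite -seq_span_rcons; apply: IHs => i si y.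
by have := h i.+1 si y; rewrite /= -cat_rcons.
Qed.

End Translation.

Section Iso.
Variables (A : comNzRingType) (L L' : lmodType A) (f : {linear L -> L'}).

Lemma supp_inj : injective f -> supp L `<=` supp L'.
Proof.
move=> f_inj p /suppP[x h]; apply/suppP; exists (f x) => a e.
by apply: h; apply: f_inj; rewrite linearZ linear0.
Qed.

Lemma seq_span_linear s x : seq_span s x -> seq_span s (f x).
Proof.
move=> /seq_spanP[y ->]; apply/seq_spanP; exists (f \o y).
by rewrite linear_sum; apply: eq_bigr => i _; rewrite linearZ.
Qed.

End Iso.

Lemma regular_sequence_iso (A : comNzRingType) (L L' : lmodType A)
    (f : {linear L -> L'}) (g : {linear L' -> L}) s :
  cancel f g -> cancel g f -> regular_sequence L s -> regular_sequence L' s.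
Proof.
move=> fK gK /regular_sequenceP[h [y hy]]; apply/regular_sequenceP; split.
  move=> i si z hz; rewrite -[z]gK; apply: seq_span_linear; apply: h => //.
  by rewrite -linearZ; exact: seq_span_linear.
by exists (f y) => /(seq_span_linear g); rewrite fK.
Qed.

Lemma cohen_macaulay_iso (A : comNzRingType) (L L' : lmodType A)
    (f : {linear L -> L'}) (g : {linear L' -> L}) :
  cancel f g -> cancel g f -> cohen_macaulay L -> cohen_macaulay L'.
Proof.
move=> fK gK.
have sE : supp L = supp L'.
  by apply/seteqP; split; apply: supp_inj; [exact: can_inj fK|exact: can_inj gK].
have rE : regular_sequence L = regular_sequence L'.
  by apply: funext => s; apply: propext; split; exact: regular_sequence_iso.
case=> [h|h]; [by left=> x; rewrite -[x]gK (h (g x)) linear0 | right].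
by move: h; rewrite /depth /krull_dim rE sE.
Qed.

(** * Cohen-Macaulay modules over a local ring *)

Lemma sup_nat_max (P : set nat) d :
  P d -> (forall n, P n -> (n <= d)%N) -> sup_nat P = (d%:E)%E.
Proof.
move=> Pd dmax; have P0 : P <> set0 by move=> P0; rewrite P0 in Pd.
rewrite /sup_nat asboolF // asboolT; last by exists d.
congr (_%:E)%E; rewrite /supremum ifF; last exact/eqP.
have sd : supremums P d by split=> // e; apply.
case: xgetP => [e _ se|/(_ d)//].
exact: (is_subset1_supremums se sd).
Qed.

Lemma bounded_max (P : set nat) n b :
  P n -> (forall m, P m -> (m <= b)%N) ->
  exists d, P d /\ forall m, P m -> (m <= d)%N.
Proof.
move=> Pn Pb.
have exP : exists m, `[< P m >] by exists n; exact/asboolP.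
have ubP : forall m, `[< P m >] -> (m <= b)%N by move=> m /asboolP/Pb.
case: (ex_maxnP exP ubP) => d /asboolP Pd dmax; exists d.
by split=> // m Pm; apply: dmax; exact/asboolP.
Qed.

Lemma sup_nat_fin (P : set nat) d :
  sup_nat P = (d%:E)%E -> forall n, P n -> (n <= d)%N.
Proof.
move=> Pd n Pn.
have [[b Pb]|ubP] := pselect (has_ubound P).
  have [m /Pb|e [Pe emax]] := @bounded_max P n b Pn; first by rewrite leEnat.
  by move: Pd; rewrite (sup_nat_max Pe emax) => -[<-]; exact: emax.
move: Pd; rewrite /sup_nat asboolF; last by move=> P0; rewrite P0 in Pn.
by rewrite asboolF.
Qed.

Section CohenMacaulayLocal.
Variables (A : comNzRingType) (hA : noetherian A) (locA : local_ring A).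
Variables (M : lmodType A) (hM : finite_module M).

Definition regular_lengths : set nat :=
  [set n | exists s : seq A,
     [/\ size s = n, forall a, a \in s -> nonunits a & regular_sequence M s]].

Definition chain_lengths : set nat :=
  [set n | exists c : 'I_n.+1 -> spec A,
     prime_chain c /\ forall i, supp M (c i)].

Lemma prime_chain_le n (c : 'I_n.+1 -> spec A) i :
  prime_chain c -> {subset c ord0 <= c i}.
Proof.
move=> cc; case: (posnP i) => [i0|i0]; last by case: (cc ord0 i i0).
by have -> : i = ord0 by exact: val_inj.
Qed.

Lemma regular_lengths_chain n (p : spec A) : regular_lengths n -> ass M p ->
  exists c : 'I_n.+1 -> spec A, prime_chain c /\ c ord0 = p.
Proof.
case=> s [<- ns sreg]; rewrite assE => Mp.
have [g gT] := hM.
apply: (regular_mod_chain hA locA gT (@set0_submodule _ M) Mp ns).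
exact: regular_sequence_mod.
Qed.

Hypotheses (M0 : exists x : M, x != 0) (cmM : cohen_macaulay M).

(** Regular sequences have bounded length, so the depth is a natural number
    attained by one of them, and it is also the dimension. *)
Lemma cm_dimension : exists d, [/\ regular_lengths d,
  forall n, chain_lengths n -> (n <= d)%N & krull_dim M = (d%:E)%E].
Proof.
have cmE : sup_nat regular_lengths = krull_dim M.
  by case: cmM => // h; case: M0 => x; rewrite (h x) eqxx.
have [r rD] : exists r, forall n, regular_lengths n -> (n <= r)%N.
  have [x /eqP x0] := M0.
  have [|r rs] := regular_size_bounded hA locA hM (@set0_submodule _ M).
    by exists x.
  exists r => n [s [<- ns sreg]]; apply: rs => //.
  exact: regular_sequence_mod.
have D0 : regular_lengths 0%N.
  exists [::]; split=> //; apply/regular_sequenceP; split=> //.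
  by have [x /eqP x0] := M0; exists x; rewrite seq_span_nil.
have [d [Dd dmax]] := bounded_max D0 rD.
move: cmE; rewrite (sup_nat_max Dd dmax) => kE; exists d; split=> //.
exact: (sup_nat_fin (esym kE)).
Qed.

(** H stands for a set of lengths of chains.  It contains all lengths of
    regular sequences, because such a length is that of a chain starting at p;
    so its supremum lies between the depth and the dimension. *)
Lemma cm_sup_eq_dim (p : spec A) (H : set nat) : ass M p ->
  (forall n (c : 'I_n.+1 -> spec A), prime_chain c -> c ord0 = p -> H n) ->
  H `<=` chain_lengths -> sup_nat H = krull_dim M.
Proof.
move=> Mp hH Hdim; have [d [Dd dmax ->]] := cm_dimension.
apply: sup_nat_max => [|n /Hdim]; last exact: dmax.
by have [c [cc c0]] := regular_lengths_chain Dd Mp; exact: hH cc c0.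
Qed.

(** Some regular sequence has length dim M, so a chain of that length starts
    at p; a strictly smaller prime of the support would make it longer. *)
Lemma cm_ass_min (p p' : spec A) :
  ass M p -> supp M p' -> {subset p' <= p} -> {subset p <= p'}.
Proof.
move=> Mp Mp' p'p; apply: contrapT => pp'.
have [d [Dd dmax _]] := cm_dimension.
have [c [cc c0]] := regular_lengths_chain Dd Mp.
have p'c : spec_lt p' (c ord0) by rewrite c0.
have [c' [cc' c'0 _]] := prime_chain_cons p'c cc.
have /dmax : chain_lengths d.+1.
  exists c'; split=> // i; apply: (supp_le _ Mp'); rewrite -c'0.
  exact: prime_chain_le.
by rewrite ltnn.
Qed.

End CohenMacaulayLocal.

(** * Primes of localizations and of quotients *)

Lemma spec_mull (A : comNzRingType) (p : spec A) a u : u \in p -> a * u \in p.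
Proof. exact: (@idealMr A (spec_idealr p)). Qed.

Lemma spec_add (A : comNzRingType) (p : spec A) u v :
  u \in p -> v \in p -> u + v \in p.
Proof. exact: rpredD. Qed.

Lemma spec_mulE (A : comNzRingType) (p : spec A) u v :
  (u * v \in p) = (u \in p) || (v \in p).
Proof. exact: (prime_idealrM (spec_idealr p)). Qed.

Lemma spec0 (A : comNzRingType) (p : spec A) : 0 \in p.
Proof. exact: (idealr0 (spec_idealr p)). Qed.

Lemma spec1 (A : comNzRingType) (p : spec A) : (1 \in p) = false.
Proof. exact: (idealr1 (spec_idealr p)). Qed.

Section SpecMap.
Variables (A B : comNzRingType) (f : {rmorphism A -> B}).

Fact comap_ideal (P : spec B) : idealr_closed (fun a => f a \in P).
Proof.
split.
- by rewrite -[_ \in _]/(f 0 \in P) rmorph0 spec0.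
- by rewrite -[_ \in _]/(f 1 \in P) rmorph1 spec1.
- move=> a u v hu hv; rewrite -[_ \in _]/(f (a * u + v) \in P).
  rewrite rmorphD rmorphM.
  by apply: spec_add => //; exact: spec_mull.
Qed.

Fact comap_prime (P : spec B) : prime_idealr_closed (fun a => f a \in P).
Proof.
move=> u v; rewrite -[_ \in _]/(f (u * v) \in P) rmorphM.
by rewrite spec_mulE.
Qed.

Definition comap (P : spec B) : spec A :=
  Spec (@comap_ideal P) (@comap_prime P).

Lemma mem_comap P a : (a \in comap P) = (f a \in P).
Proof. by []. Qed.

(** Every element of B is associated to one in the image of f.  This covers
    localizations, whose denominators are units, and quotients; it makes a
    prime of B determined by its preimage. *)
Hypothesis f_associate : forall z : B, exists a s t,
  f s * z = f a /\ t * f s = 1.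

Lemma mem_specE (P : spec B) z s t : t * f s = 1 ->
  (z \in P) = (f s * z \in P).
Proof.
move=> ts; apply/idP/idP; first exact: spec_mull.
by move/(spec_mull t); rewrite mulrA ts mul1r.
Qed.

Lemma comap_le (P P' : spec B) :
  {subset P <= P'} <-> {subset comap P <= comap P'}.
Proof.
split=> [PP' a /PP'//|h z zP]; have [a [s [t [sz ts]]]] := f_associate z.
rewrite (mem_specE _ _ ts) sz; apply: h.
by rewrite mem_comap -sz -(mem_specE _ _ ts).
Qed.

Lemma comap_chain n (c : 'I_n.+1 -> spec B) :
  prime_chain c <-> prime_chain (fun i => comap (c i)).
Proof.
by split=> cc i j /cc[h1 h2]; split; rewrite ?comap_le // -?comap_le.
Qed.

(** The prime over p consists of the elements associated to the image of an
    element of p. *)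
Lemma comap_onto (p : spec A) :
  (forall a b, f a = f b -> a \in p -> b \in p) ->
  (forall s t, t * f s = 1 -> s \notin p) ->
  exists P, comap P = p.
Proof.
move=> fp sp.
pose Q z := exists a s t, [/\ f s * z = f a, t * f s = 1 & a \in p].
pose R z : bool := `[< Q z >].
have RI : idealr_closed R.
  split.
  - apply/asboolP; exists 0, 1, 1; rewrite mulr0 rmorph0 rmorph1 mul1r.
    by rewrite spec0.
  - apply/asboolP => -[a [s [t [sa ts ap]]]]; have /negP := sp _ _ ts; apply.
    by apply: (fp a) => //; rewrite -sa mulr1.
  - move=> c x y /asboolP[a [s [t [sx ts ap]]]] /asboolP[b [r [u [ry ur bp]]]].
    have [d [v [w [vc wv]]]] := f_associate c.
    apply/asboolP; exists (r * d * a + v * s * b), (v * s * r), (w * t * u).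
    rewrite !(rmorphD, rmorphM) -sx -ry -vc; split; first by ring.
      transitivity ((w * f v) * (t * f s) * (u * f r)); first by ring.
      by rewrite wv ts ur !mul1r.
    by apply: spec_add; apply: spec_mull.
have RP : prime_idealr_closed R.
  move=> x y /asboolP[c [s [t [sxy ts cp]]]].
  have [a [r [u [rx ur]]]] := f_associate x.
  have [b [v [w [vy wv]]]] := f_associate y.
  have /negP sp' := sp _ _ ts.
  have : s * (a * b) \in p.
    apply: (fp (r * v * c)); last exact: spec_mull.
    by rewrite !rmorphM -sxy -rx -vy; ring.
  rewrite !spec_mulE => /orP[//|/orP[ap|bp]].
    by apply/orP; left; apply/asboolP; exists a, r, u.
  by apply/orP; right; apply/asboolP; exists b, v, w.
exists (Spec RI RP); apply: spec_ext => a; rewrite mem_comap.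
apply/asboolP/idP => [[b [s [t [sa ts bp]]]]|ap].
  have /negP sp' := sp _ _ ts.
  have : s * a \in p by apply: (fp b) => //; rewrite rmorphM sa.
  by rewrite spec_mulE => /orP[].
by exists a, 1, 1; rewrite rmorph1 !mul1r.
Qed.

End SpecMap.

(** * Localization at a prime *)

Section Localization.
Variables (A : comNzRingType) (q : spec A).

Notation B := (locring q).

Definition rfrac (a : A) (s : denom q) : B := loc_frac (a : A^o) s.

Definition loc_incl (a : A) : B := rfrac a (denom1 q).

Lemma rfracM a s b t : rfrac a s * rfrac b t = rfrac (a * b) (denomM s t).
Proof. exact: loc_mulE. Qed.

Lemma rfrac_scale (M : lmodType A) a s (x : M) t :
  rfrac a s *: loc_frac x t = loc_frac (a *: x) (denomM s t).
Proof. exact: loc_scaleE. Qed.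

Lemma rfrac_eqP a s b t : rfrac a s = rfrac b t <->
  exists2 u, u \notin q & u * (val t * a) = u * (val s * b).
Proof.
split=> [/loc_frac_eqP[u e]|[u uq e]].
  by exists (val u); [exact: (valP u) | rewrite !mulrA; exact: e].
apply/loc_frac_eqP; exists (exist (fun s => s \notin q) u uq).
by rewrite -[LHS]/(_ * _ * _) -[RHS]/(_ * _ * _) /= -!mulrA.
Qed.

Lemma rfrac1 s : rfrac (val s) s = 1.
Proof.
by apply/rfrac_eqP; exists 1; rewrite ?spec1 //= !mul1r mulr1.
Qed.

Fact loc_incl_additive : zmod_morphism loc_incl.
Proof.
move=> a b; rewrite /loc_incl.
rewrite -[rfrac b _]/(loc_frac _ _) -[- loc_frac _ _]/(loc_opp _) loc_oppE.
rewrite -[LHS]/(loc_frac _ _) [RHS]loc_fracD; apply: loc_frac_eq => /=.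
by rewrite !scale1r mul1r scale1r.
Qed.

Fact loc_incl_multiplicative : monoid_morphism loc_incl.
Proof. by split=> // a b; rewrite /loc_incl rfracM denomm1. Qed.

HB.instance Definition _ :=
  GRing.isZmodMorphism.Build A B loc_incl loc_incl_additive.
HB.instance Definition _ :=
  GRing.isMonoidMorphism.Build A B loc_incl loc_incl_multiplicative.

Lemma loc_incl_rfrac a s : loc_incl (val s) * rfrac a s = loc_incl a.
Proof.
rewrite rfracM; apply/rfrac_eqP; exists 1; rewrite ?spec1 //= !mul1r //.
Qed.

Lemma rfracE a s : rfrac a s = rfrac 1 s * loc_incl a.
Proof. by rewrite rfracM mul1r denommC denomm1. Qed.

Lemma rfrac1V s : rfrac 1 s * loc_incl (val s) = 1.
Proof. by rewrite mulrC loc_incl_rfrac. Qed.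

Lemma loc_incl_associate (z : B) : exists a s t,
  loc_incl s * z = loc_incl a /\ t * loc_incl s = 1.
Proof.
elim/locringW: z => a s; exists a, (val s), (rfrac 1 s).
by rewrite -[loc_frac _ _]/(rfrac _ _) loc_incl_rfrac rfrac1V.
Qed.

Lemma loc_incl_eq a b : loc_incl a = loc_incl b <->
  exists2 u, u \notin q & u * a = u * b.
Proof.
by rewrite rfrac_eqP /=; split=> -[u uq e]; exists u; rewrite ?mul1r // in e *.
Qed.

Lemma rfrac_unit a s : a \notin q <-> exists b, b * rfrac a s = 1.
Proof.
split=> [aq|[b]].
  exists (rfrac (val s) (exist (fun s => s \notin q) a aq)).
  rewrite rfracM mulrC -[1](rfrac1 (denomM s (exist (fun s => s \notin q) a aq))).
  by rewrite denommC /= mulrC.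
elim/locringW: b => b t; rewrite -[loc_frac _ _]/(rfrac _ _) rfracM.
move/rfrac_eqP => [u uq /=]; rewrite mul1r mulr1 => e.
apply/negP => aq; move: (spec_mull u (spec_mull b aq)); rewrite e.
by rewrite !spec_mulE (negPf uq) (negPf (valP t)) (negPf (valP s)).
Qed.

Lemma loc_incl_unit (s : A) (t : B) : t * loc_incl s = 1 -> s \notin q.
Proof. by move=> e; apply/(rfrac_unit s (denom1 q)); exists t. Qed.

Lemma nonunit_rfrac a s : nonunits (rfrac a s) <-> a \in q.
Proof.
split=> [h|aq b]; last first.
  by apply/eqP => e; have /negP := (rfrac_unit a s).2 (ex_intro _ b e).
apply: contrapT => /negP /(rfrac_unit a s)[b e].
by have := h b; rewrite e eqxx.
Qed.

Lemma locring_local : local_ring B.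
Proof.
elim/locringW => a s; elim/locringW => b t.
move=> /(nonunit_rfrac a s) aq /(nonunit_rfrac b t) bq.
rewrite loc_fracD; apply/nonunit_rfrac.
by apply: spec_add; exact: spec_mull.
Qed.

(** An ideal of the localization is generated by the images of generators of
    its preimage. *)
Lemma locring_noetherian : noetherian A -> noetherian B.
Proof.
move=> hA J.
have sJ := submodClosed_submodule J.
pose I : set A^o := [set a : A^o | loc_incl a \in J].
have [|s sE] := @ideal_fg A hA I.
  split; first by rewrite /I /= rmorph0; exact: (submodule0 sJ).
  move=> a b c; rewrite /I /= => hb hc; rewrite rmorphD rmorphM.
  by case: sJ => _; apply.
exists (map (fun a : A^o => loc_incl a : B^o) s); apply/seteqP; split.
  elim/locringW => a t; rewrite -[loc_frac _ _]/(rfrac a t) /= => Jat.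
  have : spanned s (a : A^o).
    rewrite -sE /I /= -(loc_incl_rfrac a t).
    exact: (submoduleZ sJ (loc_incl (val t)) Jat).
  case=> c ac; exists (fun i => rfrac (c i) t).
  rewrite rfracE [a]ac (rmorph_sum loc_incl) mulr_sumr size_map.
  apply: eq_bigr => i _; rewrite (nth_map 0) // (rfracE (c i)).
  by rewrite -[_ *: _ in RHS]/(_ * _) (rmorphM loc_incl) mulrA.
apply: spanned_min => // z /mapP[a /mem_spanned]; rewrite -sE => Ia -> //.
Qed.

Lemma locmod_finite (M : lmodType A) :
  finite_module M -> finite_module (locmod q M).
Proof.
case=> s sT; pose i x : locmod q M := loc_frac x (denom1 q).
exists (map i s); apply/seteqP; split=> // z _; elim/loc_fracW: z => x t.
have : spanned s x by rewrite sT.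
case=> c ->; exists (fun j => rfrac (c j) t).
have iD : {morph i : x y / x + y}.
  move=> y w; rewrite /i loc_fracD; apply: loc_frac_eq => /=.
  by rewrite !scale1r mul1r scale1r.
have i0 : i 0 = 0 by [].
have -> : loc_frac (\sum_(j < size s) c j *: s`_j) t =
    rfrac 1 t *: i (\sum_(j < size s) c j *: s`_j).
  by rewrite rfrac_scale scale1r denommC denomm1.
rewrite (big_morph i iD i0) scaler_sumr size_map; apply: eq_bigr => j _.
by rewrite (nth_map 0) // /i !rfrac_scale scale1r.
Qed.

Definition loc_comap : spec B -> spec A := comap loc_incl.

Lemma loc_comap_le (P : spec B) : {subset loc_comap P <= q}.
Proof.
move=> a aP; apply: contrapT => /negP /(rfrac_unit a (denom1 q))[b e].
by have := spec_mull b aP; rewrite e spec1.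
Qed.

Lemma loc_comap_onto (p : spec A) : {subset p <= q} ->
  exists P, loc_comap P = p.
Proof.
move=> pq; apply: comap_onto.
- exact: loc_incl_associate.
- move=> a b /loc_incl_eq[u uq e] ap.
  have up : u \notin p by apply: contra uq; exact: pq.
  by have := spec_mull u ap; rewrite e spec_mulE (negPf up).
- by move=> s t /loc_incl_unit; apply: contra; exact: pq.
Qed.

Lemma mem_rfrac (P : spec B) a s : (rfrac a s \in P) = (a \in loc_comap P).
Proof.
by rewrite (mem_specE _ _ (rfrac1V s)) loc_incl_rfrac.
Qed.

Lemma supp_locmod (M : lmodType A) (P : spec B) :
  supp (locmod q M) P <-> supp M (loc_comap P).
Proof.
rewrite !suppP; split=> -[].
  elim/loc_fracW => x s h; exists x => a ax; apply: (h (loc_incl a)).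
  by rewrite rfrac_scale ax; apply/loc_frac0P; exists 1; rewrite ?spec1 ?scaler0.
move=> x h; exists (loc_frac x (denom1 q)); elim/locringW => a s.
rewrite -[loc_frac _ _]/(rfrac a s) rfrac_scale => /loc_frac0P[t tq e].
have : t * a \in loc_comap P by apply: h; rewrite -scalerA.
by rewrite mem_rfrac spec_mulE => /orP[/loc_comap_le|//]; rewrite (negPf tq).
Qed.

Lemma ass_locmod (M : lmodType A) (P : spec B) :
  ass M (loc_comap P) -> ass (locmod q M) P.
Proof.
case=> x h; exists (loc_frac x (denom1 q)); elim/locringW => a s.
rewrite -[loc_frac _ _]/(rfrac a s) rfrac_scale mem_rfrac.
apply/idP/eqP => [|/loc_frac0P[t tq]].
  rewrite h => /eqP ->; apply/loc_frac0P; exists 1; by rewrite ?spec1 ?scaler0.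
rewrite scalerA => /eqP; rewrite -h spec_mulE => /orP[/loc_comap_le|//].
by rewrite (negPf tq).
Qed.

(** Under this hypothesis M / N localizes to 0 at q, so the localized inclusion
    of N in M is an isomorphism. *)
Lemma locmod_sub_cm (M : lmodType A) (N : submodClosed M) :
  (forall x : M, exists2 t, t \notin q & t *: x \in N) ->
  @cohen_macaulay B (locmod q (submod_type N)) <-> @cohen_macaulay B (locmod q M).
Proof.
move=> hN; pose S : lmodType A := submod_type N; pose L := locmod q S.
have vD (x y : S) : val (x + y) = val x + val y by [].
have vZ a (x : S) : val (a *: x) = a *: val x by [].
pose phi (z : L) : locmod q M := loc_frac (val (repr z).1) (repr z).2.
have phiE (x : S) s : phi (loc_frac x s) = loc_frac (val x) s.
  rewrite /phi; have [u e] := repr_loc_frac x s.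
  by apply/loc_frac_eqP; exists u; rewrite -!vZ e.
  clearbody phi.
have phiP a z w : phi (a *: z + w) = a *: phi z + phi w.
  elim/locringW: a => a r; elim/loc_fracW: z => x s; elim/loc_fracW: w => y t.
  rewrite -[loc_frac _ r]/(rfrac a r) rfrac_scale loc_fracD !phiE.
  rewrite rfrac_scale loc_fracD.
  by rewrite vD !vZ.
have phi_inj : injective phi.
  move=> z w; elim/loc_fracW: z => x s; elim/loc_fracW: w => y t.
  rewrite !phiE => /loc_frac_eqP[u e]; apply/loc_frac_eqP; exists u.
  by apply: val_inj; rewrite !vZ.
have /choice[psi psiK] : forall w, exists z, phi z = w.
  elim/loc_fracW => x s; have [t tq tx] := hN x.
  pose t' : denom q := exist (fun s => s \notin q) t tq.
  pose x' : S := exist _ (t *: x) tx.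
  exists (loc_frac x' (denomM t' s)); rewrite phiE; apply: loc_frac_eq => /=.
  by rewrite scalerA mulrC.
have phiK : cancel phi psi by move=> z; apply: phi_inj; rewrite psiK.
have psiP a z w : psi (a *: z + w) = a *: psi z + psi w.
  by apply: phi_inj; rewrite phiP !psiK.
pose phi' := HB.pack_for {linear L -> locmod q M} phi
  (GRing.isLinear.Build B L (locmod q M) _ phi phiP).
pose psi' := HB.pack_for {linear locmod q M -> L} psi
  (GRing.isLinear.Build B (locmod q M) L _ psi psiP).
split; first exact: (@cohen_macaulay_iso _ _ _ phi' psi').
exact: (@cohen_macaulay_iso _ _ _ psi' phi').
Qed.

End Localization.

(** * Heights in a quotient by a prime *)

Section QuotientHeight.
Variables (A : comNzRingType) (p q : spec A).
Hypothesis pq : {subset p <= q}.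

Notation Q := {ideal_quot (spec_idealr p)}.

Lemma pi_ideal_eq (a b : A) : \pi_Q a = \pi_Q b <-> a - b \in p.
Proof.
rewrite -[_ \in p]/(_ \in spec_idealr p) Quotient.idealrBE.
by split=> [->|/eqP].
Qed.

Let pi : {rmorphism A -> Q} := \pi_Q.

Lemma pi_associate (z : Q) : exists a s t, pi s * z = pi a /\ t * pi s = 1.
Proof. by exists (repr z), 1, 1; rewrite rmorph1 !mul1r /pi /= reprK. Qed.

Lemma le_pi_comap (P : spec Q) : {subset p <= comap pi P}.
Proof.
move=> a ap; rewrite mem_comap; have -> : pi a = pi 0.
  by apply/pi_ideal_eq; rewrite subr0.
by rewrite rmorph0 spec0.
Qed.

Lemma pi_comap_onto (r : spec A) : {subset p <= r} ->
  exists P, comap pi P = r.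
Proof.
move=> pr; apply: comap_onto.
- exact: pi_associate.
- move=> a b /pi_ideal_eq/pr ab ar.
  have -> : b = a + (-1) * (a - b) by rewrite mulN1r opprB addrCA subrr addr0.
  by apply: spec_add => //; exact: spec_mull.
- move=> s t; elim/quotW: t => t e; apply/negP => sr.
  have : pi (t * s) = pi 1 by rewrite rmorphM rmorph1.
  move=> /pi_ideal_eq/pr; have -> : t * s - 1 = t * s + (-1) * 1 by rewrite mulr1.
  move=> h; have : 1 \in r.
    have -> : 1 = t * s + (-1) * (t * s + (-1) * 1) by rewrite mulr1; ring.
    by apply: spec_add; exact: spec_mull.
  by rewrite spec1.
Qed.

Lemma quotient_heightE : quotient_height q p =
  sup_nat [set n | exists c : 'I_n.+1 -> spec A,
    [/\ prime_chain c, {subset p <= c ord0} & c ord_max = q]].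
Proof.
rewrite /quotient_height /height; congr sup_nat; apply/seteqP; split=> n.
  case=> c [cc cE]; exists (fun i => comap pi (c i)); split.
  - exact: (comap_chain pi_associate c).1.
  - exact: le_pi_comap.
  - apply: spec_ext => a; rewrite mem_comap.
    have -> : (pi a \in c ord_max) = `[< [set x | x \in c ord_max] (pi a) >].
      by rewrite asboolb.
    rewrite cE; apply/asboolP/idP => [[b bq /pi_ideal_eq ba]|aq]; last by exists a.
    have -> : a = b + (-1) * (b - a) by rewrite mulN1r opprB addrCA subrr addr0.
    by apply: spec_add => //; apply: spec_mull; exact: pq.
case=> c [cc pc cq].
have /choice[P PE] : forall i, exists P, comap pi P = c i.
  move=> i; apply: pi_comap_onto => a /pc; exact: prime_chain_le.
exists P; split.
  by apply: (comap_chain pi_associate P).2; rewrite (funext PE).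
apply/seteqP; split=> z /=.
  have [a aE] : exists a, pi a = z by exists (repr z); rewrite /pi /= reprK.
  by rewrite -aE -mem_comap PE cq => aq; exists a.
by case=> a aq <-; rewrite -[_ \in _]/(a \in comap pi (P ord_max)) PE cq.
Qed.

End QuotientHeight.

(** * The Cohen-Macaulay locus *)

Lemma prime_chain_le_max (A : comNzRingType) n (c : 'I_n.+1 -> spec A) i :
  prime_chain c -> {subset c i <= c ord_max}.
Proof.
move=> cc; have := leq_ord i; rewrite leq_eqVlt => /orP[/eqP im|im].
  by have -> : i = ord_max by exact: val_inj.
by case: (cc i ord_max im).
Qed.

Lemma prime_chain_last (A : comNzRingType) n (c : 'I_n.+1 -> spec A)
    (q : spec A) :
  prime_chain c -> {subset c ord_max <= q} ->
  prime_chain (fun i => if i == ord_max then q else c i).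
Proof.
move=> cc cq i j ij; have [h1 h2] := cc i j ij.
have -> : (i == ord_max) = false.
  by apply/eqP => im; have := leq_trans ij (leq_ord j); rewrite im ltnn.
case: eqP => [jm|_] //; rewrite jm in h1 h2.
by split=> [a /h1/cq //|h]; apply: h2 => a /cq/h.
Qed.

Section CohenMacaulayPoint.
Variables (A : comNzRingType) (M : lmodType A) (q p : spec A).
Hypotheses (hA : noetherian A) (hM : finite_module M).
Hypotheses (qM : CM_locus M q) (Mp : ass M p) (pq : {subset p <= q}).

Let hB : noetherian (locring q) := locring_noetherian hA.
Let hL : finite_module (locmod q M) := locmod_finite q hM.
Let M0 : exists x : locmod q M, x != 0 := supp_le pq (ass_supp Mp).

Lemma cm_point_min : min_supp M p.
Proof.
split=> [|p' Mp' p'p]; first exact: ass_supp.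
have [P PE] := loc_comap_onto pq.
have [|P' P'E] := @loc_comap_onto A q p'; first by move=> a /p'p/pq.
apply: spec_ext => a; apply/idP/idP => [/p'p //|].
rewrite -PE -P'E; apply: (comap_le (@loc_incl_associate A q) P P').1.
apply: (cm_ass_min hB (@locring_local A q) hL M0 qM).
- by apply: ass_locmod; rewrite PE.
- by apply/supp_locmod; rewrite P'E.
- apply: (comap_le (@loc_incl_associate A q) P' P).2.
  by rewrite -[comap _ P']/(loc_comap P') -[comap _ P]/(loc_comap P) PE P'E.
Qed.

(** Chains of A between p and q are chains of the localized support, and
    chains of the localization starting at p give back chains of A. *)
Lemma cm_point_height : quotient_height q p = krull_dim (locmod q M).
Proof.
have [P PE] := loc_comap_onto pq.
rewrite quotient_heightE //.
apply: (cm_sup_eq_dim hB (@locring_local A q) hL M0 qM (p := P)).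
- by apply: ass_locmod; rewrite PE.
- move=> n c cc c0.
  (* Such a chain may end below q; its last prime can be replaced by q. *)
  exists (fun i => if i == ord_max then q else loc_comap (c i)); split.
  + apply: prime_chain_last; last exact: loc_comap_le.
    exact: (comap_chain (@loc_incl_associate A q) c).1.
  + by case: ifP => // _; rewrite c0 PE.
  + by rewrite eqxx.
- move=> n [c [cc pc cq]].
  have /choice[C CE] : forall i, exists Q : spec (locring q), loc_comap Q = c i.
    move=> i; apply: loc_comap_onto; rewrite -cq; exact: prime_chain_le_max.
  exists C; split.
    apply: (comap_chain (@loc_incl_associate A q) C).2.
    by rewrite -[fun _ => _]/(fun i => loc_comap (C i)) (funext CE).
  move=> i; apply/supp_locmod; rewrite CE; apply: (supp_le _ (ass_supp Mp)).
  by move=> a /pc; exact: prime_chain_le.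
Qed.

End CohenMacaulayPoint.

Lemma ass_quotmod_avoid (A : comNzRingType) (M : lmodType A)
    (N : submodClosed M) (q : spec A) :
  noetherian A -> (forall p, ass (quotmod N) p -> ~ {subset p <= q}) ->
  forall x : M, exists2 t, t \notin q & t *: x \in N.
Proof.
move=> hA hN x; apply: contrapT => h.
have sN := submodClosed_submodule N.
have [||s sq sx|p [Np _ pq]] :=
  @ass_mod_exists A hA M _ [set t | t \notin q] x sN.
- by rewrite /= spec1.
- by move=> s t /= sq tq; rewrite spec_mulE negb_or sq.
- by apply: h; exists s.
rewrite -ass_quotmod in Np; apply: (hN p Np) => a ap.
by apply: contrapT => /negP /pq; rewrite ap.
Qed.

Theorem lemma3p2 (A : comNzRingType) (M : lmodType A)
  (hA : noetherian A) (hM : finite_module M) (hM0 : exists x : M, x != 0)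
  (Msub : set (spec A) -> submodClosed M)
  (hMsub : forall T, equiheight_sets M T ->
     ass (submod_type (Msub T)) = T /\
     ass (quotmod (Msub T)) = ass M `\` T) :
  CM_locus M =
  \bigcup_(T in equiheight_sets M)
    (CM_locus (submod_type (Msub T)) `\`
     \bigcup_(p in ass M `\` T) spec_closed p).
Proof.
(* M^T and M agree at the primes containing no associated prime outside T. *)
have cmE T (q : spec A) : equiheight_sets M T ->
    (forall p, ass M p -> ~ T p -> ~ {subset p <= q}) ->
    CM_locus (submod_type (Msub T)) q <-> CM_locus M q.
  move=> hT hq; apply: locmod_sub_cm; apply: ass_quotmod_avoid => // p.
  by rewrite (hMsub T hT).2 => -[]; exact: hq.
apply/seteqP; split=> q; last first.
  case=> T hT [cmT avT]; apply/(cmE T q hT) => // p Mp Tp pq.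
  by apply: avT; exists p.
move=> cmq; pose T : set (spec A) := [set p | ass M p /\ {subset p <= q}].
have avT p : ass M p -> ~ T p -> ~ {subset p <= q}.
  by move=> Mp Tp pq; apply: Tp.
have hT : equiheight_sets M T.
  split; first by move=> p [Mp pq]; exact: (cm_point_min hA hM cmq Mp pq).
  have [Mq|Mq] := pselect (supp M q).
    exists q => //; exists (krull_dim (locmod q M)) => p [Mp pq].
    by split=> //; exact: cm_point_height.
  have [x x0] := hM0.
  (* Here T is empty, so any prime of the support will do. *)
  have [|||r [Mr _ _]] :=
    @ass_mod_exists A hA M [set 0] [set 1] x (@set0_submodule _ M).
  - by [].
  - by move=> a b -> ->; rewrite /= mulr1.
  - by move=> s ->; rewrite scale1r; exact/eqP.
  rewrite -assE in Mr; exists r; first exact: ass_supp.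
  exists 0%E => p [Mp pq]; case: Mq; exact: supp_le pq (ass_supp Mp).
exists T => //; split; first exact/(cmE T q hT).
by case=> p [Mp Tp]; exact: avT.
Qed.
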